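(* Let $\mathfrak{H},\mathfrak{K}$ be complex Hilbert spaces and let $T,B:\mathfrak{H}\to\mathfrak{K}$ be closed densely defined linear operators. Then the following statements are equivalent: (1) $\mathrm{dom}\,B\subseteq\mathrm{dom}\,T$ and, for some $\lambda\ge0$, $\|Tf\|_{\mathfrak{K}}^2\le\lambda\,(Tf,Bf)_{\mathfrak{K}}$ for all $f\in\mathrm{dom}\,B$; (2) $\mathrm{dom}\,B\subseteq\mathrm{dom}\,T$ and, for some $\lambda\ge0$, $\|Tf\|_{\mathfrak{K}}^2\le\lambda\,(Tf,Bf)_{\mathfrak{K}}\le\lambda^2\|Bf\|_{\mathfrak{K}}^2$ for all $f\in\mathrm{dom}\,B$; (3) $T^*T\le\lambda H\le\lambda^2B^*B$ for some $\lambda\ge0$ and some operator $H$ in $\mathfrak{H}$ with $0\le H=H^*\subseteq B^*T$; (4) $T^*T\le\lambda H$ for some $\lambda\ge0$ and some operator $H$ in $\mathfrak{H}$ with $0\le H=H^*\subseteq B^*T$ and $\mathrm{dom}\,B\subseteq\mathrm{dom}\,H^{1/2}$. In particular, if $B^*T$ is selfadjoint, then $H=B^*T$ (for $H$ as in (3) or (4)).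
   Context: Operators are linear and possibly unbounded. Inclusion of operators is inclusion of graphs. $B^*T$ has the natural domain $\{f\in\mathrm{dom}\,T: Tf\in\mathrm{dom}\,B^*\}$. Inequalities between nonnegative selfadjoint operators are in the form sense: for a nonnegative selfadjoint operator $H$ in $\mathfrak{H}$ and $\lambda\ge0$, $T^*T\le\lambda H$ means $\mathrm{dom}\,H^{1/2}\subseteq\mathrm{dom}\,T$ and $\|Tf\|_{\mathfrak{K}}^2\le\lambda\|H^{1/2}f\|_{\mathfrak{H}}^2$ for all $f\in\mathrm{dom}\,H^{1/2}$; and $\lambda H\le\lambda^2B^*B$ means $\mathrm{dom}\,B\subseteq\mathrm{dom}\,H^{1/2}$ and $\lambda\|H^{1/2}f\|_{\mathfrak{H}}^2\le\lambda^2\|Bf\|_{\mathfrak{K}}^2$ for all $f\in\mathrm{dom}\,B$. An inequality involving $(Tf,Bf)_{\mathfrak{K}}$ includes the claim that the quantities compared are real. *)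

(* Defs.v *)
From HB Require Import structures.
From mathcomp Require Import all_boot all_order all_algebra.
From mathcomp Require Import all_classical all_reals all_analysis.
From mathcomp Require Import complex.

Set Implicit Arguments.
Unset Strict Implicit.
Unset Printing Implicit Defensive.

Import Order.TTheory GRing.Theory Num.Theory.
Import numFieldNormedType.Exports.

Local Open Scope classical_set_scope.
Local Open Scope ring_scope.
Local Open Scope complex_scope.

(* Complex Hilbert spaces. The inner product is linear in its first argument.
   Norms and inner products both take values in R[i], where x <= y holds iff
   y - x is a nonnegative real; so an inequality between a norm and an inner
   product includes the claim that the inner product is real. *)
HB.mixin Record isHilbert (R : realType) V of CompleteNormedModule R[i] V := {
  hdot : {dot V for (@Num.conj R[i])} ;
  hdot_norm : forall x : V, hdot x x = `|x| ^+ 2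
}.

#[short(type="hilbertType")]
HB.structure Definition Hilbert (R : realType) :=
  {V of isHilbert R V & CompleteNormedModule R[i] V}.

Notation "''[' u , v ]" := (hdot u v) : ring_scope.

(* Possibly unbounded operators are represented by their graphs, so equality
   and inclusion of operators are equality and inclusion of sets. *)
Section Operators.
Variables (R : realType).
Implicit Types U V W : hilbertType R.

Definition is_operator U V (T : set (U * V)) :=
  submod_closed (mem T) /\ (forall f g g', T (f, g) -> T (f, g') -> g = g').

Definition dom U V (T : set (U * V)) : set U := [set f | exists g, T (f, g)].

(* The value T f, for f in the domain of the operator T; 0 for other f. *)
Definition opval U V (T : set (U * V)) (f : U) : V :=
  xget 0 [set g | T (f, g)].

Definition closed_densely_defined U V (T : set (U * V)) :=
  [/\ is_operator T, closed T & dense (dom T)].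

Definition adjoint U V (T : set (U * V)) : set (V * U) :=
  [set gh | forall f, dom T f -> '[opval T f, gh.1] = '[f, gh.2]].

Definition opcomp U V W (S : set (V * W)) (T : set (U * V)) : set (U * W) :=
  [set fh | exists2 g, T (fh.1, g) & S (g, fh.2)].

Definition selfadjoint U (H : set (U * U)) :=
  [/\ is_operator H, dense (dom H) & H = adjoint H].

Definition nonneg_selfadjoint U (H : set (U * U)) :=
  selfadjoint H /\ (forall f, dom H f -> 0 <= '[opval H f, f]).

(* H^(1/2), the nonnegative selfadjoint operator whose square is H; it exists
   and is unique for every nonnegative selfadjoint H. *)
Definition opsqrt U (H : set (U * U)) : set (U * U) :=
  xget set0 [set S | nonneg_selfadjoint S /\ opcomp S S = H].

(* The inequality a S^*S <= b T^*T in the form sense. As H = S^*S for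
   S = H^(1/2), inequalities that involve H are stated with opsqrt H. *)
Definition form_le U V W (a : R) (S : set (U * V)) (b : R) (T : set (U * W)) :=
  dom T `<=` dom S /\
  (forall f, dom T f -> a%:C * `|opval S f| ^+ 2 <= b%:C * `|opval T f| ^+ 2).

Definition factor U V (T B : set (U * V)) (H : set (U * U)) :=
  nonneg_selfadjoint H /\ H `<=` opcomp (adjoint B) T.

(* T^*T <= l H <= l^2 B^*B *)
Definition factor_between U V (T B : set (U * V)) (l : R) (H : set (U * U)) :=
  [/\ factor T B H, form_le 1 T l (opsqrt H)
    & form_le l (opsqrt H) (l ^+ 2) B].

(* T^*T <= l H and dom B is contained in dom H^(1/2) *)
Definition factor_above U V (T B : set (U * V)) (l : R) (H : set (U * U)) :=
  [/\ factor T B H, form_le 1 T l (opsqrt H) & dom B `<=` dom (opsqrt H)].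

End Operators.

(* Main.v *)
Require Import Defs.
From HB Require Import structures.
From mathcomp Require Import all_boot all_order all_algebra.
From mathcomp Require Import all_classical all_reals all_analysis.
From mathcomp Require Import complex.
From mathcomp Require Import ring lra.

Set Implicit Arguments.
Unset Strict Implicit.
Unset Printing Implicit Defensive.

Import Order.TTheory GRing.Theory Num.Theory.
Import numFieldNormedType.Exports.

Local Open Scope classical_set_scope.
Local Open Scope ring_scope.
Local Open Scope complex_scope.

(** Assume that [|T f|^2 <= l (T f, B f)] on [dom B]. Then
    [t(f, g) = (T f, B g)] is a nonnegative hermitian form on [dom B], and it is
    closable, because a [t]-Cauchy sequence [f_n] makes [T f_n] converge and [T]
    is closed. Let [H] be the restriction of [B^* T] to the domain of the
    closure of [t] ([TB_operator]). It is symmetric and nonnegative, and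
    [f + H f = x] is solved by minimizing
    [|f|^2 + t(f, f) - 2 Re (f, x)] on [dom B], so [H] is selfadjoint
    ([TB_operator_nsa]). The closure of [t] is the form of [H]: with
    [S = H^(1/2)] one gets [dom B <= dom S] and [|S f|^2 = (T f, B f)] on
    [dom B], and [|T f|^2 <= l |S f|^2] on [dom S]. Together with
    [l (T f, B f) <= l^2 |B f|^2], which is read off from [|l B f - T f|^2 >= 0]
    ([form_bound]), this gives the factorization.

    Conversely, let [H] be a nonnegative selfadjoint restriction of [B^* T] with
    [T^* T <= l H] and [dom B <= dom S]. For [u] in [dom H] and [f] in [dom B],
    [(T u, B f) = (H u, f) = (S u, S f)]. As [dom H] is a core of [S]
    ([root_core_dom]) this extends to [u] in [dom S] ([root_extend]), and
    [u = f] gives [(T f, B f) = |S f|^2] ([root_form_eq]); multiplied by [l],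
    this is at least [|T f|^2].

    Only two tools from Hilbert space theory are needed. The first is a form of
    the Riesz representation theorem for incomplete inner product spaces
    ([riesz_seq]): a bounded functional is the limit of the functionals defined
    by a Cauchy sequence of vectors. It gives the operator [H], the range of
    [1 + H], the core property, and the density criterion. The core property is
    used for any square root of [H], so uniqueness of [H^(1/2)] plays no role.
    The second is the existence of [H^(1/2)] ([nsa_sqrt]): with
    [G = (1 + H)^-1], [a = G^(1/2)] and [b = (1 - G)^(1/2)], its graph is the
    set of the pairs [(a x, b x)]. The roots of selfadjoint contractions come
    from the iteration [Y := (X + Y^2) / 2], which converges in norm to a
    solution of [(1 - Y)^2 = 1 - X] ([sac_sqrt]).

    Throughout, inner products are replaced by their real parts; on complex
    subspaces nothing is lost, because ['i f] may be substituted for [f]. *)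

(** * Real quadratic polynomials and real sequences *)

Section RealFacts.
Variable R : realType.

(** A real quadratic polynomial without negative values has a nonpositive
    discriminant. *)
Lemma quad_ge0 (c d k : R) :
  (forall t, 0 <= c + 2 * t * d + t ^+ 2 * k) -> d ^+ 2 <= c * k.
Proof.
move=> h; have c0 : 0 <= c by have := h 0; nra.
have k0 : 0 <= k.
  rewrite leNgt; apply/negP => k0.
  have d0 := sqr_ge0 d.
  (* If k < 0, then the sum of the values at 1 + s and - (1 + s) is negative. *)
  pose s := (c + d ^+ 2 + 2) / (- k).
  have sk : s * k = - (c + d ^+ 2 + 2).
    rewrite /s; field; lra.
  have s0 : 0 <= s by rewrite /s divr_ge0 //; lra.
  have h1 := h (1 + s); have h2 := h (- (1 + s)).
  nra.
have [k1|k1] := eqVneq k 0; last first.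
  (* The minimum is attained at - d / k. *)
  have := h (- d / k) => h1.
  have k2 : 0 < k by rewrite lt_neqAle eq_sym k1.
  have : 0 <= (c + 2 * (- d / k) * d + (- d / k) ^+ 2 * k) * k.
    by rewrite mulr_ge0.
  have -> : (c + 2 * (- d / k) * d + (- d / k) ^+ 2 * k) * k = c * k - d ^+ 2.
    by field.
  lra.
subst k.
have [->|d0] := eqVneq d 0; first by rewrite expr0n mulr0.
(* At this point the affine function c + 2 t d takes the value - 1. *)
have := h (- (c + 1) / (2 * d)); rewrite mulr0 addr0.
have -> : c + 2 * (- (c + 1) / (2 * d)) * d = - 1 by field.
by rewrite oppr_ge0 ler10.
Qed.

Lemma cvg0P (a : nat -> R) : a @ \oo --> (0 : R) <->
  (forall e : R, 0 < e -> exists N, forall n, (N <= n)%N -> `|a n| < e).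
Proof.
split => [h e e0|h].
  have /cvgrPdist_lt/(_ e e0)[N _ hN] := h.
  by exists N => n Nn; have /= := hN _ Nn; rewrite sub0r normrN.
apply/cvgrPdist_lt => e e0; have [N hN] := h e e0.
by exists N => // n /= Nn; rewrite sub0r normrN; apply: hN.
Qed.

Lemma cvg0_le (a b : nat -> R) : (forall n, `|a n| <= b n) ->
  b @ \oo --> (0 : R) -> a @ \oo --> (0 : R).
Proof.
move=> h hb; apply: (@squeeze_cvgr _ _ _ _ (fun n => - b n) b).
- by apply: nearW => n; rewrite -ler_norml.
- by rewrite -oppr0; apply: cvgN.
- exact: hb.
Qed.

Lemma cvg_le_cvg (a b : nat -> R) l c : a @ \oo --> l -> b @ \oo --> c ->
  (forall n, a n <= b n) -> l <= c.
Proof. by move=> ha hb h; apply: (ler_cvg_to ha hb); apply: nearW. Qed.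

Lemma cvg_le_const (a : nat -> R) l c : a @ \oo --> l ->
  (forall n, a n <= c) -> l <= c.
Proof. by move=> ha; apply: (cvg_le_cvg ha (cvg_cst c)). Qed.

Lemma cvg_ge_const (a : nat -> R) l c : a @ \oo --> l ->
  (forall n, c <= a n) -> c <= l.
Proof. exact: (cvg_le_cvg (cvg_cst c)). Qed.

Lemma cvg_inj (a : nat -> R) (l c : R) :
  a @ \oo --> l -> a @ \oo --> c -> l = c.
Proof. by move=> h1 h2; apply: cvg_unique h1 h2; apply: norm_hausdorff. Qed.

Lemma cvg_harm_const (k : R) : (fun n => k / n.+1%:R) @ \oo --> (0 : R).
Proof.
rewrite -(mulr0 k); apply: cvgM; first exact: cvg_cst.
exact: (@cvg_harmonic R).
Qed.

Lemma sqr_cvg0 (a : nat -> R) : (fun n => a n ^+ 2 : R) @ \oo --> (0 : R) ->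
  a @ \oo --> (0 : R).
Proof.
move=> /cvg0P h; apply/cvg0P => e e0.
have [N hN] := h (e ^+ 2) (exprn_gt0 _ e0); exists N => n /hN.
by rewrite normrX ltr_pXn2r // ?nnegrE ?ltW.
Qed.

End RealFacts.

(** * The real inner product and convergence of sequences *)

(** Cauchy sequences for a nonnegative quadratic form [s]. *)
Definition cauchy2 (R : realType) (W : lmodType R[i]) (s : W -> R)
    (u : nat -> W) :=
  forall e : R, 0 < e -> exists N, forall n m, (N <= n)%N -> (N <= m)%N ->
    s (u n - u m) < e.

Section RealInnerProduct.
Variables (R : realType) (V : hilbertType R).
Implicit Types (x y z : V) (a : R[i]) (r : R).

(** The real part of the inner product, a real inner product. On complex
    subspaces it determines the inner product (see [hdotE]). *)
Definition rdot x y : R := complex.Re '[x, y].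

(** The norm, as an element of R. *)
Definition rnorm x : R := complex.Re `|x|.

Lemma rdotDl x y z : rdot (x + y) z = rdot x z + rdot y z.
Proof. by rewrite /rdot linearDl raddfD. Qed.

Lemma rdotC x y : rdot x y = rdot y x.
Proof.
have e (z : R[i]) : complex.Re z^* = complex.Re z by case: z.
by rewrite /rdot hermC expr0 mul1r /= e.
Qed.

Lemma rdotDr x y z : rdot x (y + z) = rdot x y + rdot x z.
Proof. by rewrite rdotC rdotDl !(rdotC _ x). Qed.

Lemma rdotZ a x y : rdot (a *: x) y = rdot x (a^* *: y).
Proof.
by rewrite /rdot linearZl_LR linearZr_LR /= conjCK.
Qed.

Lemma rdotZl r x y : rdot (r%:C *: x) y = r * rdot x y.
Proof.
rewrite /rdot linearZl_LR /=.
by case: ('[x, y]) => a b /=; rewrite mul0r subr0.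
Qed.

Lemma rdotZr r x y : rdot x (r%:C *: y) = r * rdot x y.
Proof. by rewrite rdotC rdotZl rdotC. Qed.

Lemma rdotNl x y : rdot (- x) y = - rdot x y.
Proof.
by have := rdotZl (-1) x y; rewrite raddfN /= scaleN1r mulN1r.
Qed.

Lemma rdotNr x y : rdot x (- y) = - rdot x y.
Proof. by rewrite rdotC rdotNl rdotC. Qed.

Definition rdotE := (rdotDl, rdotDr, rdotZl, rdotZr, rdotNl, rdotNr).

Lemma rdot0l x : rdot 0 x = 0.
Proof. by rewrite -(subrr x) !rdotE subrr. Qed.

Lemma rdot0r x : rdot x 0 = 0.
Proof. by rewrite rdotC rdot0l. Qed.

Lemma hdotE x y : '[x, y] = Complex (rdot x y) (- rdot ('i%C *: x) y).
Proof.
rewrite /rdot linearZl_LR /=.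
by case: ('[x, y]) => a b /=; congr Complex; ring.
Qed.

Lemma normE x : `|x| = (rnorm x)%:C.
Proof.
rewrite /rnorm; have := normr_ge0 x.
by case: (`|x|) => a b; rewrite lecE /= => /andP[/eqP -> _].
Qed.

Lemma rnorm_ge0 x : 0 <= rnorm x.
Proof. by rewrite -lecR -normE normr_ge0. Qed.

Lemma rdotxx x : rdot x x = rnorm x ^+ 2.
Proof. by rewrite /rdot hdot_norm normE -rmorphXn. Qed.

Lemma rdotxx_ge0 x : 0 <= rdot x x.
Proof. by rewrite rdotxx sqr_ge0. Qed.

Lemma rnorm_eq0 x : rnorm x = 0 -> x = 0.
Proof. by move=> h; apply/eqP; rewrite -normr_eq0 normE h. Qed.

Lemma rnorm0 : rnorm 0 = 0.
Proof. by rewrite /rnorm normr0. Qed.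

Lemma rdotxx_eq0 x : rdot x x <= 0 -> x = 0.
Proof.
rewrite rdotxx => h; apply: rnorm_eq0; apply/eqP.
by rewrite -sqrf_eq0 eq_le h sqr_ge0.
Qed.

Lemma rnormD x y : rnorm (x + y) <= rnorm x + rnorm y.
Proof. by rewrite -lecR rmorphD /= -!normE ler_normD. Qed.

Lemma rnormB x y : rnorm (x - y) = rnorm (y - x).
Proof. by rewrite /rnorm distrC. Qed.

Lemma rnormZ r x : rnorm (r%:C *: x) = `|r| * rnorm x.
Proof.
apply/eqP; rewrite -(@eqrXn2 _ 2) ?rnorm_ge0 ?mulr_ge0 ?rnorm_ge0 //.
by rewrite -rdotxx !rdotE exprMn real_normK ?num_real // rdotxx mulrA expr2.
Qed.

Lemma rnormZc a x : rnorm (a *: x) = complex.Re `|a| * rnorm x.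
Proof.
rewrite /rnorm normrZ normE normc_def /=.
by rewrite mul0r subr0.
Qed.

Lemma rdot_CS2 x y : rdot x y ^+ 2 <= rdot x x * rdot y y.
Proof.
apply: quad_ge0 => t.
have := rdotxx_ge0 (x + t%:C *: y); rewrite !rdotE (rdotC y x); lra.
Qed.

Lemma rdot_CS x y : `|rdot x y| <= rnorm x * rnorm y.
Proof.
rewrite -(@ler_pXn2r _ 2) ?nnegrE // ?mulr_ge0 ?rnorm_ge0 //.
by rewrite real_normK ?num_real // exprMn -!rdotxx rdot_CS2.
Qed.

(** Convergence of a sequence of vectors, expressed by a real sequence. *)
Definition tends (u : nat -> V) x :=
  (fun n => rnorm (u n - x)) @ \oo --> (0 : R).

Lemma tendsE u x : tends u x <->
  forall e : R, 0 < e -> exists N, forall n, (N <= n)%N -> rnorm (u n - x) < e.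
Proof.
rewrite /tends cvg0P; split=> h e /h [N hN]; exists N => n /hN;
by rewrite ger0_norm ?rnorm_ge0.
Qed.

Lemma tends_cst x : tends (fun=> x) x.
Proof.
rewrite /tends subrr rnorm0; exact: cvg_cst.
Qed.

Lemma tendsD u v x y : tends u x -> tends v y ->
  tends (fun n => u n + v n) (x + y).
Proof.
move=> hu hv.
apply: (@cvg0_le R _ (fun n => rnorm (u n - x) + rnorm (v n - y))).
  move=> n; rewrite ger0_norm ?rnorm_ge0 //.
  by rewrite opprD addrACA rnormD.
by rewrite -(addr0 0); apply: cvgD.
Qed.

Lemma tendsZ a u x : tends u x -> tends (fun n => a *: u n) (a *: x).
Proof.
move=> hu; rewrite /tends.
under eq_fun do rewrite -scalerBr rnormZc.
rewrite -(mulr0 (complex.Re `|a|)); apply: cvgM => //; exact: cvg_cst.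
Qed.

Lemma tendsN u x : tends u x -> tends (fun n => - u n) (- x).
Proof.
move=> /(tendsZ (-1)); rewrite scaleN1r.
by under eq_fun do rewrite scaleN1r.
Qed.

Lemma tendsB u v x y : tends u x -> tends v y ->
  tends (fun n => u n - v n) (x - y).
Proof. by move=> hu hv; apply: tendsD => //; apply: tendsN. Qed.

Lemma tends_bound (u : nat -> V) x (f : nat -> V) y :
  tends u x -> (forall n, rnorm (f n - y) <= rnorm (u n - x)) -> tends f y.
Proof.
move=> hu h; apply: cvg0_le hu => n; by rewrite ger0_norm ?rnorm_ge0.
Qed.

Lemma tends_rdotl u x y : tends u x ->
  (fun n => rdot (u n) y) @ \oo --> rdot x y.
Proof.
move=> hu; have -> : rdot x y = rdot x y + 0 by rewrite addr0.
have -> : (fun n => rdot (u n) y) = (fun n => rdot x y + rdot (u n - x) y).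
  by apply/funext => n; rewrite !rdotE; lra.
apply: cvgD; first exact: cvg_cst.
apply: (@cvg0_le R _ (fun n => rnorm (u n - x) * rnorm y)).
  by move=> n; apply: rdot_CS.
by rewrite -(mul0r (rnorm y)); apply: cvgM => //; apply: cvg_cst.
Qed.

Lemma tends_rdotr u x y : tends u x ->
  (fun n => rdot y (u n)) @ \oo --> rdot y x.
Proof.
rewrite rdotC => /tends_rdotl h.
by under eq_fun do rewrite rdotC; apply: h.
Qed.

Lemma tends_rnorm u x : tends u x -> (fun n => rnorm (u n)) @ \oo --> rnorm x.
Proof.
move=> hu; have -> : rnorm x = rnorm x + 0 by rewrite addr0.
have -> : (fun n => rnorm (u n)) = (fun n => rnorm x + (rnorm (u n) - rnorm x)).
  by apply/funext => n; lra.
apply: cvgD; first exact: cvg_cst.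
apply: cvg0_le hu => n.
have h1 := rnormD (u n - x) x; have h2 := rnormD (x - u n) (u n).
rewrite subrK in h1; rewrite subrK rnormB in h2.
by rewrite ler_norml; lra.
Qed.

Lemma tends_rdotxx u x : tends u x ->
  (fun n => rdot (u n) (u n)) @ \oo --> rdot x x.
Proof.
move=> /tends_rnorm hu; rewrite rdotxx.
under eq_fun do rewrite rdotxx expr2.
by rewrite expr2; apply: cvgM.
Qed.

Lemma rdot_inj x y : (forall z, rdot x z = rdot y z) -> x = y.
Proof.
move=> h; apply/eqP; rewrite -subr_eq0; apply/eqP/rdotxx_eq0.
by rewrite !(rdotDl, rdotNl) h subrr.
Qed.

Lemma tends_unique u x y : tends u x -> tends u y -> x = y.
Proof.
move=> hx hy; apply: rdot_inj => z.
exact: cvg_inj (tends_rdotl hx) (tends_rdotl hy).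
Qed.

Lemma tendsP u x : tends u x -> u @ \oo --> x.
Proof.
move=> hu; apply/cvgrPdist_lt => e e0.
have er : e = (complex.Re e)%:C.
  by case: e e0 => a b; rewrite ltcE /= => /andP[/eqP -> _].
have e1 : 0 < complex.Re e by rewrite -ltcR -er.
have /tendsE/(_ _ e1)[N hN] := hu; exists N => // n /= /hN.
by rewrite distrC normE er ltcR.
Qed.

Lemma cvg_tends (u : nat -> V) x : u @ \oo --> x -> tends u x.
Proof.
move=> /cvgrPdist_lt hu; apply/tendsE => e e0.
have e1 : 0 < e%:C by rewrite ltcR.
have [N _ hN] := hu _ e1; exists N => n /hN /=.
by rewrite distrC normE ltcR.
Qed.

Lemma cauchy2_tends u : cauchy2 (fun x => rdot x x) u -> exists x, tends u x.
Proof.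
move=> h; suff /cauchy_cvg/cvg_ex[x hx] : cauchy (u @ \oo).
  by exists x; apply: cvg_tends.
apply: cauchy_exP => e e0.
have er : e = (complex.Re e)%:C.
  by case: e e0 => a b; rewrite ltcE /= => /andP[/eqP -> _].
have e1 : 0 < complex.Re e by rewrite -ltcR -er.
have [N hN] := h (complex.Re e ^+ 2) (exprn_gt0 _ e1).
exists (u N); exists N => // n /= Nn.
rewrite -ball_normE /= normE er ltcR.
have := hN N n (leqnn _) Nn; rewrite rdotxx.
by rewrite ltr_pXn2r // ?nnegrE ?rnorm_ge0 ?ltW.
Qed.

Lemma tends_cauchy2 u x : tends u x -> cauchy2 (fun x => rdot x x) u.
Proof.
move=> hu e e0.
have e4 : 0 < e / 4 by lra.
have /tendsE/(_ (Num.sqrt (e / 4))) := hu.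
rewrite sqrtr_gt0 e4 => /(_ erefl)[N hN]; exists N => n m Nn Nm.
have h2 := hN _ Nn; have h1 := hN _ Nm.
have h3 := rnormD (u n - x) (x - u m).
rewrite addrA subrK (rnormB x) in h3.
rewrite rdotxx; have := rnorm_ge0 (u n - u m).
have s0 : 0 <= Num.sqrt (e / 4) by rewrite sqrtr_ge0.
have := sqr_sqrtr (ltW e4).
nra.
Qed.

End RealInnerProduct.

Lemma tends_pair_closed (R : realType) (U V : hilbertType R) (T : set (U * V))
    u v x y : closed T -> (forall n, T (u n, v n)) -> tends u x -> tends v y ->
  T (x, y).
Proof.
move=> cT Tn /tendsP hu /tendsP hv.
apply: (@closed_cvg _ _ \oo _ (fun n => (u n, v n)) T cT) => //.
  by apply: nearW.
exact: cvg_pair.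
Qed.

(** * Representation of bounded functionals by minimizing sequences *)

Section Riesz.
Variables (R : realType) (U : lmodType R[i]).
Variables (D : set U) (s : U -> U -> R) (phi : U -> R).

(** [s] is a symmetric, real bilinear and nonnegative form on the real subspace
    [D]; nothing is required of [s] outside [D]. *)
Record pre_form : Prop := PreForm {
  pf_dom : forall (r : R) x y, D x -> D y -> D (r%:C *: x + y);
  pf_sym : forall x y, D x -> D y -> s x y = s y x;
  pf_lin : forall (r : R) x y z, D x -> D y -> D z ->
    s (r%:C *: x + y) z = r * s x z + s y z;
  pf_ge0 : forall x, D x -> 0 <= s x x }.

Lemma form_CS x y : pre_form -> D x -> D y -> s x y ^+ 2 <= s x x * s y y.
Proof.
move=> [hd hs hl hp] Dx Dy; rewrite mulrC; apply: quad_ge0 => t.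
have Dz := hd t _ _ Dx Dy.
have := hp _ Dz; rewrite hl // !(hs _ (_ + _)) // !hl // (hs y x) //; lra.
Qed.

(** A bounded linear functional on a possibly incomplete inner product space
    is represented by a Cauchy sequence, namely any sequence that minimizes
    [s x x - 2 phi x]. *)
Lemma riesz_seq (M : R) : 0 <= M -> pre_form -> D !=set0 ->
  (forall (r : R) x y, D x -> D y -> phi (r%:C *: x + y) = r * phi x + phi y) ->
  (forall x, D x -> phi x ^+ 2 <= M * s x x) ->
  exists e : nat -> U, [/\ forall n, D (e n),
    cauchy2 (fun x => s x x) e
    & forall h, D h -> (fun n => s (e n) h) @ \oo --> phi h].
Proof.
move=> M0 [hd hs hl hp] [d0 Dd0] pl pM.
pose J x := s x x - 2 * phi x.
have JM x : D x -> - M <= J x.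
  move=> Dx; have := pM _ Dx; have := hp _ Dx; rewrite /J.
  move: (s x x) (phi x) => a p a0 pa; rewrite leNgt; apply/negP => h.
  have := sqr_ge0 (a - M); nra.
pose A := [set J x | x in D].
have iA : has_inf A.
  split; first by exists (J d0); exists d0.
  by exists (- M) => _ [x Dx <-]; apply: JM.
have AJ x : D x -> inf A <= J x.
  by move=> Dx; apply: ge_inf; [case: iA|exists x].
have ex n : exists x, D x /\ J x < inf A + n.+1%:R^-1.
  have n0 : 0 < n.+1%:R^-1 :> R by rewrite invr_gt0 ltr0n.
  by have [_ [x Dx <-] h] := inf_adherent n0 iA; exists x.
pose e n := projT1 (cid (ex n)).
have De n : D (e n) by rewrite /e; case: cid => x [].
have Je n : J (e n) < inf A + n.+1%:R^-1 by rewrite /e; case: cid => x [].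
have sr r x y z : D x -> D y -> D z -> s z (r%:C *: x + y) = r * s z x + s z y.
  by move=> Dx Dy Dz; rewrite hs ?hl ?(hs z) //; apply: hd.
have DB x y : D x -> D y -> D (x - y).
  move=> Dx Dy; have := hd (-1) y x Dy Dx.
  by rewrite raddfN /= scaleN1r addrC.
exists e; split => //.
- move=> r r0.
  have [N hN] : exists N, forall n, (N <= n)%N -> n.+1%:R^-1 < r / 4.
    have r4 : 0 < r / 4 by lra.
    have /cvg0P/(_ _ r4)[N hN] := cvg_harm_const (1 : R).
    exists N => n Nn; have /= := hN _ Nn.
    by rewrite mul1r ger0_norm // invr_ge0.
  exists N => n m Nn Nm.
  (* Parallelogram identity at the midpoint of e n and e m. *)
  have := AJ (2^-1%:C *: ((1%:C *: e n) + e m)).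
  have D1 : D (1%:C *: e n + e m) by apply: hd.
  have D0 : D 0 by rewrite -(subrr d0); apply: DB.
  have D2 : D (2^-1%:C *: ((1%:C *: e n) + e m)).
    by have := hd 2^-1 _ _ D1 D0; rewrite addr0.
  move=> /(_ D2).
  have s0 z : D z -> s 0 z = 0.
    move=> Dz; have := hl 1 0 0 z D0 D0 Dz.
    by rewrite scaler0 addr0; lra.
  have p0 : phi 0 = 0.
    by have := pl 1 0 0 D0 D0; rewrite scaler0 addr0; lra.
  have s1 r' x z : D x -> D z -> s (r'%:C *: x) z = r' * s x z.
    by move=> Dx Dz; have := hl r' x 0 z Dx D0 Dz; rewrite addr0 s0 // addr0.
  have s2 r' x z : D x -> D z -> s z (r'%:C *: x) = r' * s z x.
    move=> Dx Dz; rewrite hs ?s1 ?(hs z) //.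
    by have := hd r' x 0 Dx D0; rewrite addr0.
  have p1 r' x : D x -> phi (r'%:C *: x) = r' * phi x.
    by move=> Dx; have := pl r' x 0 Dx D0; rewrite addr0 p0 addr0.
  rewrite /J s1 // s2 // p1 // hl // !sr // pl //.
  have -> : e n - e m = (-1)%:C *: e m + e n.
    by rewrite raddfN /= scaleN1r addrC.
  rewrite hl // ?sr //; last by apply: hd.
  have := Je n; have := Je m; rewrite /J.
  rewrite (hs (e m) (e n)) //.
  have := hN _ Nn; have := hN _ Nm.
  move: (n.+1%:R^-1) (m.+1%:R^-1) (inf A) (s (e n) (e n)) (s (e m) (e m))
    (s (e n) (e m)) (phi (e n)) (phi (e m)) => a b i snn smm snm pn pm.
  by rewrite !mul1r; lra.
- move=> h Dh.
  have key n : (s (e n) h - phi h) ^+ 2 <= s h h / n.+1%:R.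
    (* The defect of the Euler equation is bounded by that of minimality. *)
    have q : (s (e n) h - phi h) ^+ 2 <= (J (e n) - inf A) * s h h.
      apply: quad_ge0 => t.
      have Dt : D (t%:C *: h + e n) by apply: hd.
      have := AJ _ Dt; rewrite /J hl // !sr // pl // (hs h (e n)) //.
      lra.
    apply: (le_trans q); rewrite mulrC; apply: ler_wpM2l; first exact: hp.
    by rewrite lerBlDl ltW // Je.
  apply/subr_cvg0.
  apply: sqr_cvg0; apply: cvg0_le (cvg_harm_const (s h h)) => n.
  by rewrite ger0_norm ?sqr_ge0.
Qed.

End Riesz.

(** * Square roots of selfadjoint contractions *)

Section SquareRoot.
Variables (R : realType) (V : hilbertType R).

(** Selfadjoint contractions defined on the whole space. As the operator is
    complex linear, symmetry for the real inner product is symmetry. *)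
Record sa_contraction (X : V -> V) : Prop := SAContraction {
  sac_lin : forall (a : R[i]) x y, X (a *: x + y) = a *: X x + X y;
  sac_sym : forall x y, rdot (X x) y = rdot x (X y);
  sac_norm : forall x, rnorm (X x) <= rnorm x }.

Lemma sac0 X : sa_contraction X -> X 0 = 0.
Proof.
move=> [h _ _]; have := h (-1) 0 0.
by rewrite scaleN1r oppr0 addr0 scaleN1r addNr.
Qed.

Lemma sacZ X a x : sa_contraction X -> X (a *: x) = a *: X x.
Proof.
move=> sX; have [h _ _] := sX.
by have := h a x 0; rewrite addr0 (sac0 sX) addr0.
Qed.

Lemma sacD X x y : sa_contraction X -> X (x + y) = X x + X y.
Proof. by move=> [h _ _]; have := h 1 x y; rewrite !scale1r. Qed.

Lemma sacB X x y : sa_contraction X -> X (x - y) = X x - X y.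
Proof.
by move=> sX; rewrite sacD // -scaleN1r sacZ // scaleN1r.
Qed.

Lemma tends_sac X u x : sa_contraction X -> tends u x -> tends (X \o u) (X x).
Proof.
move=> sX hu; apply: (tends_bound hu) => n /=.
by rewrite -sacB //; apply: sac_norm.
Qed.

Variable X : V -> V.
Hypothesis sX : sa_contraction X.

(** The iteration [Y := (X + Y^2) / 2], and the same iteration started from
    the number 1 in place of X, which controls it in norm. *)
Fixpoint sqrt_iter n (x : V) : V :=
  if n is m.+1 then (2^-1 : R)%:C *: (X x + sqrt_iter m (sqrt_iter m x)) else 0.

Fixpoint sqrt_bound n : R :=
  if n is m.+1 then 2^-1 * (1 + sqrt_bound m ^+ 2) else 0.

Let Y := sqrt_iter.
Let r := sqrt_bound.

Lemma sqrt_bound01 n : 0 <= r n <= 1.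
Proof.
elim: n => [|n /andP[h0 h1]]; rewrite /r /= ?lexx ?ler01 //.
rewrite -/r; apply/andP; split; nra.
Qed.

Lemma sqrt_bound_le n : r n <= r n.+1.
Proof.
rewrite /r /= -/r; have := sqr_ge0 (1 - r n); nra.
Qed.

Lemma sqrt_bound_nd : {homo r : n m / (n <= m)%N >-> n <= m}.
Proof. by apply/nondecreasing_seqP; apply: sqrt_bound_le. Qed.

Lemma sqrt_bound_cvg : exists l : R, r @ \oo --> l.
Proof.
apply/cvg_ex; apply: nondecreasing_is_cvgn.
  by move=> n m /sqrt_bound_nd.
by exists 1 => _ [n _ <-]; case/andP: (sqrt_bound01 n).
Qed.

Lemma sqrt_iterL n a x y : Y n (a *: x + y) = a *: Y n x + Y n y.
Proof.
elim: n x y => [|n ih] x y; rewrite /Y /=; first by rewrite scaler0 addr0.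
rewrite -/Y !ih (sac_lin sX) scalerA (mulrC a) -scalerA -scalerDr.
by congr (_ *: _); rewrite scalerDr addrACA.
Qed.

Lemma sqrt_iterB n x y : Y n (x - y) = Y n x - Y n y.
Proof.
have := sqrt_iterL n (-1) y x.
by rewrite !scaleN1r addrC => ->; rewrite addrC.
Qed.

Lemma sqrt_iterS n x y : rdot (Y n x) y = rdot x (Y n y).
Proof.
elim: n x y => [|n ih] x y; rewrite /Y /= ?rdot0l ?rdot0r // -/Y.
by rewrite !rdotE (sac_sym sX) !ih.
Qed.

Lemma sqrt_iterC Z n x : sa_contraction Z -> (forall x, Z (X x) = X (Z x)) ->
  Z (Y n x) = Y n (Z x).
Proof.
move=> sZ h; elim: n x => [|n ih] x; rewrite /Y /= ?(sac0 sZ) // -/Y.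
by rewrite sacZ // sacD // h !ih.
Qed.

Lemma sqrt_iter_norm n x : rnorm (Y n x) <= r n * rnorm x.
Proof.
elim: n x => [|n ih] x; rewrite /Y /r /= ?rnorm0 ?mul0r // -/Y -/r.
rewrite rnormZ ger0_norm ?invr_ge0 // -mulrA ler_pM2l ?invr_gt0 ?ltr0n //.
apply: (le_trans (rnormD _ _)); rewrite mulrDl mul1r; apply: lerD.
  exact: sac_norm.
apply: (le_trans (ih _)); rewrite expr2 -mulrA; apply: ler_wpM2l => //.
by case/andP: (sqrt_bound01 n).
Qed.

Lemma sqrt_iter_sac n : sa_contraction (Y n).
Proof.
split; [exact: sqrt_iterL|exact: sqrt_iterS|move=> x].
apply: (le_trans (sqrt_iter_norm n x)).
case/andP: (sqrt_bound01 n) => _ h; have := rnorm_ge0 x; nra.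
Qed.

Lemma sqrt_iterCC n m x : Y m (Y n x) = Y n (Y m x).
Proof.
apply: sqrt_iterC; first exact: sqrt_iter_sac.
by move=> y; rewrite (@sqrt_iterC X).
Qed.

(** The differences factor as [(Y_(n+1) + Y_n) (Y_(n+1) - Y_n) / 2], because
    the iterates commute. *)
Lemma sqrt_iter_step n x : rnorm (Y n.+1 x - Y n x) <= (r n.+1 - r n) * rnorm x.
Proof.
elim: n x => [|n ih] x.
  rewrite /Y /r /= subr0 addr0 rnormZ ger0_norm ?invr_ge0 //.
  have := sac_norm sX x; rewrite subr0 expr0n addr0; lra.
have -> : Y n.+2 x - Y n.+1 x = (2^-1 : R)%:C *:
    (Y n.+1 (Y n.+1 x - Y n x) + Y n (Y n.+1 x - Y n x)).
  rewrite [Y n.+2 x]/Y [sqrt_iter n.+2 x]/= -/Y -/(Y n.+1).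
  rewrite [X in _ - X]/Y [X in _ - X]/= -/Y -scalerBr.
  congr (_ *: _); rewrite !sqrt_iterB (sqrt_iterCC n n.+1).
  rewrite opprD addrACA subrr add0r.
  by rewrite addrA subrK.
have -> : r n.+2 - r n.+1 = 2^-1 * ((r n.+1 + r n) * (r n.+1 - r n)).
  have -> : r n.+2 = 2^-1 * (1 + r n.+1 ^+ 2) by [].
  have : r n.+1 = 2^-1 * (1 + r n ^+ 2) by [].
  move: (r n.+1) (r n) => a b; lra.
rewrite rnormZ ger0_norm ?invr_ge0 // -mulrA ler_pM2l ?invr_gt0 ?ltr0n //.
apply: (le_trans (rnormD _ _)); rewrite -mulrA mulrDl.
case/andP: (sqrt_bound01 n) => h0 _; case/andP: (sqrt_bound01 n.+1) => h1 _.
by apply: lerD; apply: (le_trans (sqrt_iter_norm _ _)); apply: ler_wpM2l.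
Qed.

Lemma sqrt_iter_diff n m x : (n <= m)%N ->
  rnorm (Y m x - Y n x) <= (r m - r n) * rnorm x.
Proof.
move=> /subnK <-; elim: (m - n)%N => [|k ih].
  by rewrite add0n !subrr rnorm0 mul0r.
have := sqrt_iter_step (k + n) x; rewrite addSn.
have := rnormD (Y (k + n).+1 x - Y (k + n) x) (Y (k + n) x - Y n x).
rewrite addrA subrK; lra.
Qed.

Lemma sqrt_iter_cvg x : exists y, tends (Y^~ x) y.
Proof.
apply: cauchy2_tends => e e0.
have [l rl] := sqrt_bound_cvg.
(* The denominator is kept positive, as x may be zero. *)
pose d := Num.sqrt e / (rnorm x + 1).
have x0 := rnorm_ge0 x.
have s0 : 0 < Num.sqrt e by rewrite sqrtr_gt0.
have d0 : 0 < d / 2 by rewrite !divr_gt0 //; lra.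
have /cvgrPdist_lt/(_ _ d0)[N _ hN] := rl.
exists N => n m; wlog nm : n m / (n <= m)%N => [hw Nn Nm|Nn Nm].
  case/orP: (leq_total n m) => h; first exact: hw.
  by rewrite rdotxx rnormB -rdotxx; apply: hw.
have h := sqrt_iter_diff x nm.
have h1 : r m - r n < d.
  have /= := hN n Nn; have /= := hN m Nm; rewrite !ltr_norml.
  by move=> /andP[? ?] /andP[? ?]; lra.
have h2 : 0 <= r m - r n by rewrite subr_ge0 sqrt_bound_nd.
rewrite rdotxx rnormB -(sqr_sqrtr (ltW e0)).
rewrite ltr_pXn2r // ?nnegrE ?rnorm_ge0 ?ltW //.
apply: (le_lt_trans h).
have -> : Num.sqrt e = d * (rnorm x + 1) by rewrite /d divfK //; lra.
nra.
Qed.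

(** Selfadjoint contractions of the form [1 - X] have a square root of the
    form [1 - Y], where [Y] commutes with every selfadjoint contraction that
    commutes with [X]. *)
Lemma sac_sqrt : exists Y0 : V -> V, [/\ sa_contraction Y0,
  forall x, (x - Y0 x) - Y0 (x - Y0 x) = x - X x
  & forall Z, sa_contraction Z -> (forall x, Z (X x) = X (Z x)) ->
     forall x, Z (Y0 x) = Y0 (Z x)].
Proof.
pose Y0 x := projT1 (cid (sqrt_iter_cvg x)).
have hY x : tends (Y^~ x) (Y0 x) by rewrite /Y0; case: cid.
have sY : sa_contraction Y0.
  split.
  - move=> a x y; apply: (tends_unique (hY _)).
    have -> : Y^~ (a *: x + y) = (fun n => a *: Y n x + Y n y).
      by apply/funext => n; apply: sqrt_iterL.
    by apply: tendsD => //; apply: tendsZ.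
  - move=> x y; have h := tends_rdotl (y := y) (hY x).
    apply: (cvg_inj h).
    have -> : (fun n => rdot (Y n x) y) = (fun n => rdot x (Y n y)).
      by apply/funext => n; apply: sqrt_iterS.
    exact: tends_rdotr.
  - move=> x; apply: (cvg_le_const (tends_rnorm (hY x))) => n.
    exact: (sac_norm (sqrt_iter_sac n)).
exists Y0; split=> //.
- move=> x.
  have fixp : Y0 x = (2^-1 : R)%:C *: (X x + Y0 (Y0 x)).
    have h : tends (fun n => Y n.+1 x) (Y0 x).
      apply/tendsE => e e0; have /tendsE/(_ e e0)[N hN] := hY x.
      by exists N => n Nn; apply: hN; apply: leqW.
    apply: (tends_unique h); rewrite /Y /= -/Y; apply: tendsZ; apply: tendsD.
      exact: tends_cst.
    have -> : (fun n => Y n (Y n x)) =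
        (fun n => Y n (Y n x - Y0 x) + Y n (Y0 x)).
      by apply/funext => n; rewrite sqrt_iterB subrK.
    rewrite -[Y0 (Y0 x)]add0r; apply: tendsD => //.
    apply: (tends_bound (hY x)) => n; rewrite subr0.
    exact: (sac_norm (sqrt_iter_sac n)).
  rewrite sacB //; apply: rdot_inj => z.
  by have := congr1 (fun w => rdot w z) fixp; rewrite !rdotE; lra.
- move=> Z sZ h x.
  have h1 := tends_sac sZ (hY x).
  apply: (tends_unique h1).
  have -> : Z \o Y^~ x = Y^~ (Z x).
    by apply/funext => n /=; apply: sqrt_iterC.
  exact: hY.
Qed.

End SquareRoot.

(** * Operators as graphs *)

Section Operators.
Variables (R : realType) (U V : hilbertType R).
Implicit Types T : set (U * V).

Lemma is_operatorP T : is_operator T <->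
  [/\ T (0, 0), forall a f g f' g', T (f, g) -> T (f', g') ->
        T (a *: f + f', a *: g + g') & forall g, T (0, g) -> g = 0].
Proof.
split=> [[[h0 h1] h2]|[h0 h1 h2]].
- have T00 : T (0, 0) by move: h0; rewrite inE.
  split=> [//|a f g f' g' Tf Tf'|g Tg]; last exact: (h2 _ _ _ Tg T00).
  have := h1 a (f, g) (f', g'); rewrite !inE; exact.
- split; first split.
  + by rewrite inE.
  + by move=> a [f g] [f' g']; rewrite !inE; apply: h1.
  + move=> f g g' Tg Tg'.
    have := h1 (-1) _ _ _ _ Tg Tg'.
    by rewrite !scaleN1r addNr => /h2/eqP; rewrite addrC subr_eq0 => /eqP.
Qed.

Lemma opval_eq T f g : is_operator T -> T (f, g) -> opval T f = g.
Proof.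
move=> [_ h] Tfg; rewrite /opval; case: xgetP => [g' _ /= Tg'|h'].
  exact: h Tg' Tfg.
by case: (h' g).
Qed.

Lemma opvalP T f : dom T f -> T (f, opval T f).
Proof. by move=> [g Tg]; rewrite /opval; case: xgetP => [//|/(_ g)]. Qed.

(** For complex linear operators the real parts of the inner products
    determine the adjoint. *)
Lemma adjointP T g h : is_operator T ->
  adjoint T (g, h) <-> (forall f k, T (f, k) -> rdot k g = rdot f h).
Proof.
move=> oT; split=> [ad f k Tf|ad f /opvalP Tf] /=.
  have := ad f; rewrite (opval_eq oT Tf) /= => e.
  by rewrite /rdot e //; exists k.
have /is_operatorP[T0 Tl _] := oT.
(* The imaginary part is the real part of the product with 'i f. *)
have Tif := Tl 'i%C _ _ _ _ Tf T0; rewrite !addr0 in Tif.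
by rewrite !hdotE (ad _ _ Tf) (ad _ _ Tif).
Qed.

Lemma adjoint_comb T a g h g' h' : is_operator T -> adjoint T (g, h) ->
  adjoint T (g', h') -> adjoint T (a *: g + g', a *: h + h').
Proof.
move=> oT; move=> /adjointP-/(_ oT) h1 /adjointP-/(_ oT) h2.
apply/adjointP => // f k Tf; rewrite !(rdotDr, h2 _ _ Tf).
have /is_operatorP[T0 Tl _] := oT.
(* The scalar is moved to the other side, into the domain of T. *)
have := Tl a^* _ _ _ _ Tf T0; rewrite !addr0 => /h1.
by rewrite !rdotZ conjCK => ->.
Qed.

End Operators.

(** * Density and orthogonality *)

Section Density.
Variables (R : realType) (U : hilbertType R).
Implicit Types D : set U.

Lemma dense_orth D x : dense D -> (forall u, D u -> rdot u x = 0) -> x = 0.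
Proof.
move=> dD h; apply: rnorm_eq0; apply/eqP; rewrite eq_le rnorm_ge0 andbT.
rewrite leNgt; apply/negP => x0.
pose e : R := rnorm x / 2.
have e0 : 0 < e by rewrite /e; lra.
have e1 : 0 < e%:C by rewrite ltcR.
have [] := dD (ball x e%:C); [|exact: ball_open|].
  by exists x; apply: ballxx.
move=> u [xu Du].
have xu' : rnorm (x - u) < e.
  by move: xu; rewrite -ball_normE /= normE ltcR.
have := rdot_CS (x - u) x; rewrite !rdotE (h _ Du) subr0 rdotxx.
rewrite ler_norml => /andP[_]; rewrite /e in xu'; nra.
Qed.

(** The projection theorem, for a subspace with trivial orthogonal
    complement. *)
Lemma orth_dense D : (forall a x y, D x -> D y -> D (a *: x + y)) -> D 0 ->
  (forall x, (forall u, D u -> rdot u x = 0) -> x = 0) -> dense D.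
Proof.
move=> Dl D0 h O [x Ox] oO.
have pD : pre_form D (@rdot R U).
  split.
  - by move=> r y z; apply: Dl.
  - by move=> y z _ _; rewrite rdotC.
  - by move=> r y z w _ _ _; rewrite !rdotE.
  - by move=> y _; apply: rdotxx_ge0.
have [] := @riesz_seq R U D (@rdot R U) (fun y => rdot y x) (rdot x x)
  (rdotxx_ge0 x) pD.
- by exists 0.
- by move=> r y z _ _; rewrite !rdotE.
- by move=> y _; rewrite mulrC rdot_CS2.
move=> e [De ce he].
have [y ey] := cauchy2_tends ce.
have xy : x = y.
  apply/eqP; rewrite -subr_eq0; apply/eqP/h => u Du.
  rewrite !rdotE; apply/eqP; rewrite subr_eq0; apply/eqP.
  by apply: (cvg_inj (he u Du)); rewrite rdotC; apply: tends_rdotl.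
have /tendsP := ey; rewrite -xy => /(_ O).
have nO : nbhs x O by apply: open_nbhs_nbhs; split.
by move=> /(_ nO)[N _ hN]; exists (e N); split=> //; apply: hN => /=.
Qed.

End Density.

(** * Nonnegative selfadjoint operators and cores of their square roots *)

Section NonnegSelfadjoint.
Variables (R : realType) (U : hilbertType R).
Implicit Types H S : set (U * U).

(** Nonnegative selfadjoint operators, described by the real inner product and
    by the elements of the graph: the equality with the adjoint is split into
    symmetry and maximality. *)
Record nsa H : Prop := NSA {
  nsa_op : is_operator H;
  nsa_dense : dense (dom H);
  nsa_sym : forall u y u' y', H (u, y) -> H (u', y') -> rdot y u' = rdot u y';
  nsa_ge0 : forall u y, H (u, y) -> 0 <= rdot y u;
  nsa_max : forall g h, (forall u y, H (u, y) -> rdot y g = rdot u h) ->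
    H (g, h) }.

Lemma nsaP H : nonneg_selfadjoint H <-> nsa H.
Proof.
split=> [[[oH dH eH] pH]|[oH dH sH pH mH]].
- have sH u y u' y' : H (u, y) -> H (u', y') -> rdot y u' = rdot u y'.
    by move=> Hu; rewrite [X in X _ -> _]eH => /adjointP-/(_ oH)/(_ _ _ Hu).
  split=> //.
  + move=> u y Hu; have du : dom H u by exists y.
    by have := pH u du; rewrite (opval_eq oH Hu) lecE => /andP[].
  + by move=> g h gh; rewrite eH; apply/adjointP.
- split; first split=> //.
  + apply/seteqP; split=> -[g h].
    * by move=> Hg; apply/adjointP => // f k Hf; apply: sH.
    * by move=> /adjointP-/(_ oH) gh; apply: mH.
  + move=> u /opvalP Hu; rewrite lecE /=; apply/andP; split; last exact: pH Hu.
    rewrite hdotE /= oppr_eq0; set y := opval H u in Hu *.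
    have /is_operatorP[H0 Hl _] := oH.
    have := Hl 'i%C _ _ _ _ Hu H0; rewrite !addr0 => Hiu.
    have h1 := sH _ _ _ _ Hu Hiu.
    have h2 : rdot ('i%C *: y) u = - rdot y ('i%C *: u).
      rewrite rdotZ -rdotNr; congr rdot.
      rewrite -scaleNr; congr (_ *: _).
      by apply/eqP; rewrite eq_complex /= oppr0 !eqxx.
    rewrite rdotC -h1 in h2; apply/eqP; rewrite rdotC.
    by lra.
Qed.

Lemma nsa_comb H a u y u' y' : nsa H -> H (u, y) -> H (u', y') ->
  H (a *: u + u', a *: y + y').
Proof. by move=> /nsa_op/is_operatorP[_ h _]; apply: h. Qed.

Lemma nsa_sub H u y u' y' : nsa H -> H (u, y) -> H (u', y') ->
  H (u - u', y - y').
Proof.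
move=> nH Hu Hu'; have := nsa_comb (-1) nH Hu' Hu.
by rewrite !scaleN1r ![- _ + _]addrC.
Qed.

Lemma nsa_closed H u v x y : nsa H -> (forall n, H (u n, v n)) ->
  tends u x -> tends v y -> H (x, y).
Proof.
move=> nH Hn ux vy; apply: (nsa_max nH) => w z Hw.
apply: (cvg_inj (tends_rdotr (y := z) ux)).
under eq_fun do rewrite (nsa_sym nH Hw (Hn _)).
exact: tends_rdotr.
Qed.

(** - 1 is not an eigenvalue of a nonnegative operator. *)
Lemma nsa_eigen H g : nsa H -> H (g, - g) -> g = 0.
Proof.
by move=> nH /(nsa_ge0 nH); rewrite rdotNl oppr_ge0 => /rdotxx_eq0.
Qed.

(** The range of [1 + H] has trivial orthogonal complement. *)
Lemma nsa_orth H g : nsa H ->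
  (forall u y, H (u, y) -> rdot (u + y) g = 0) -> g = 0.
Proof.
move=> nH h; apply: (nsa_eigen nH); apply: (nsa_max nH) => u y /h.
by rewrite rdotDl rdotNr; lra.
Qed.

(** A nonnegative symmetric operator with [ran (1 + H) = U] is selfadjoint. *)
Lemma nsa_range H : is_operator H ->
  (forall u y u' y', H (u, y) -> H (u', y') -> rdot y u' = rdot u y') ->
  (forall u y, H (u, y) -> 0 <= rdot y u) ->
  (forall x, exists u, H (u, x - u)) -> nsa H.
Proof.
move=> oH sH pH rH; have /is_operatorP[H0 Hl Hf] := oH.
split=> //.
- apply: orth_dense.
  + by move=> a x y [x' Hx] [y' Hy]; exists (a *: x' + y'); apply: Hl.
  + by exists 0.
  + move=> x hx; have [u Hu] := rH x.
    have xu : rdot u x = 0 by apply: hx; exists (x - u).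
    have := pH _ _ Hu; rewrite !rdotE (rdotC x) xu.
    rewrite add0r oppr_ge0 => /rdotxx_eq0 u0; move: Hu.
    by rewrite u0 subr0 => /Hf.
- move=> g h gh; have [u Hu] := rH (g + h).
  suff gu : g = u by move: Hu; rewrite -gu addrC addKr.
  apply/eqP; rewrite -subr_eq0; apply/eqP.
  have [v Hv] := rH (g - u); apply: rdotxx_eq0.
  have := gh _ _ Hv; have := sH _ _ _ _ Hv Hu; rewrite !rdotE.
  have := rdotC v g; have := rdotC v u; have := rdotC g u; lra.
Qed.

(** The Cauchy-Schwarz inequality for a sum of two forms. *)
Lemma CS_sum (a b p q P Q : R) : 0 <= p -> 0 <= q -> 0 <= P -> 0 <= Q ->
  a ^+ 2 <= p * P -> b ^+ 2 <= q * Q -> (a + b) ^+ 2 <= (P + Q) * (p + q).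
Proof.
move=> p0 q0 P0 Q0 ha hb.
have h : 2 * (a * b) <= p * Q + q * P.
  rewrite leNgt; apply/negP => h.
  have h0 : 0 <= p * Q + q * P by rewrite addr_ge0 // mulr_ge0.
  have h1 : (p * Q + q * P) ^+ 2 < (2 * (a * b)) ^+ 2.
    by rewrite ltr_pXn2r // nnegrE //; lra.
  have h2 : a ^+ 2 * b ^+ 2 <= (p * P) * (q * Q).
    by apply: ler_pM => //; rewrite sqr_ge0.
  have := sqr_ge0 (p * Q - q * P); lra.
nra.
Qed.

Section SquareRootCore.
Variables S H : set (U * U).
Hypotheses (nS : nsa S) (nH : nsa H) (SH : opcomp S S = H).

Lemma root_split u y : H (u, y) -> exists2 w, S (u, w) & S (w, y).
Proof. by rewrite -SH. Qed.

Lemma root_form u w y : S (u, w) -> S (w, y) -> rdot y u = rdot w w.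
Proof. by move=> Su Sw; rewrite rdotC (nsa_sym nS Su Sw). Qed.

(** If the functional [(u + H u, f)] of [u] in [dom H] is bounded for the norm
    of the graph of [S], then [f] belongs to [dom S] and is approximated in that
    norm by elements of [dom H]. *)
Lemma root_core (M : R) f : 0 <= M ->
  (forall u y, H (u, y) ->
     rdot (u + y) f ^+ 2 <= M * (rdot u u + rdot y u)) ->
  exists u w y v, [/\ forall n, S (u n, w n) /\ S (w n, y n),
    tends u f, tends w v & S (f, v)].
Proof.
move=> M0 hM.
pose s (p q : U * U) : R := rdot p.1 q.1 + rdot p.2 q.1.
pose phi (p : U * U) : R := rdot (p.1 + p.2) f.
have pf : pre_form H s.
  split.
  - by move=> r [u y] [u' y']; apply: nsa_comb.
  - move=> [u y] [u' y'] Hu Hu'; rewrite /s /= (rdotC u).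
    by rewrite (nsa_sym nH Hu Hu') (rdotC u).
  - by move=> r [u y] [u' y'] [u2 y2] _ _ _; rewrite /s /= !rdotE; ring.
  - move=> [u y] Hu; rewrite /s /= addr_ge0 ?rdotxx_ge0 //.
    exact: (nsa_ge0 nH).
have /is_operatorP[H0 _ _] := nsa_op nH.
have [] := riesz_seq (phi := phi) M0 pf.
- by exists (0, 0).
- by move=> r [u y] [u' y'] _ _; rewrite /phi /= !rdotE; ring.
- by move=> [u y] Hu; apply: hM.
move=> e [He ce limh].
have ex n : exists w, S ((e n).1, w) /\ S (w, (e n).2).
  have := He n; case: (e n) => u y /root_split[w h1 h2]; by exists w.
pose w n := projT1 (cid (ex n)).
have Sw n : S ((e n).1, w n) /\ S (w n, (e n).2) by rewrite /w; case: cid.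
have se n m : s (e n - e m) (e n - e m) =
    rdot ((e n).1 - (e m).1) ((e n).1 - (e m).1) + rdot (w n - w m) (w n - w m).
  rewrite /s /=; congr (_ + _); have [h1 h2] := Sw n; have [h3 h4] := Sw m.
  by apply: root_form; apply: nsa_sub.
have [|u ue] := @cauchy2_tends R U (fun n => (e n).1).
  move=> r /ce[N hN]; exists N => n m Nn Nm; apply: le_lt_trans (hN _ _ Nn Nm).
  by rewrite se lerDl rdotxx_ge0.
have [|v vw] := @cauchy2_tends R U w.
  move=> r /ce[N hN]; exists N => n m Nn Nm; apply: le_lt_trans (hN _ _ Nn Nm).
  by rewrite se lerDr rdotxx_ge0.
have Suv : S (u, v).
  by apply: (nsa_closed nS) ue vw => n; case: (Sw n).
suff fu : f = u.
  exists (fun n => (e n).1), w, (fun n => (e n).2), v.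
  by rewrite fu; split.
apply/eqP; rewrite -subr_eq0; apply/eqP; apply: (nsa_orth nH) => u1 y1 H1.
rewrite rdotDr rdotNr; apply/eqP; rewrite subr_eq0; apply/eqP.
apply: (cvg_inj (limh _ H1)).
have -> : (fun n => s (e n) (u1, y1)) = (fun n => rdot (u1 + y1) (e n).1).
  apply/funext => n; rewrite /s /= !rdotE.
  have Hn : H ((e n).1, (e n).2) by have := He n; case: (e n).
  by rewrite (nsa_sym nH Hn H1) (rdotC u1) (rdotC y1).
exact: tends_rdotr.
Qed.

(** The domain of [H = S^2] is a core of [S]. *)
Lemma root_core_dom f v : S (f, v) ->
  exists u w y, [/\ forall n, S (u n, w n) /\ S (w n, y n),
    tends u f & tends w v].
Proof.
move=> Sf; have [|u y Hu|u [w [y [v' [h1 h2 h3 h4]]]]] :=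
  @root_core (rdot f f + rdot v v) f.
- by rewrite addr_ge0 ?rdotxx_ge0.
- have [w Su Sw] := root_split Hu.
  rewrite (root_form Su Sw) rdotDl (nsa_sym nS Sw Sf).
  by apply: CS_sum; rewrite ?rdotxx_ge0 ?rdot_CS2.
- exists u, w, y; split=> //.
  by have [_ /(_ _ _ _ Sf h4) ->] := nsa_op nS.
Qed.

End SquareRootCore.
End NonnegSelfadjoint.

(** * The resolvent and the square root of an unbounded operator *)

Section Resolvent.
Variables (R : realType) (U : hilbertType R).
Implicit Types H S : set (U * U).

(** [ran (1 + H) = U]: the range of [1 + H] is closed, because
    [|u| <= |u + H u|], and has trivial orthogonal complement. *)
Lemma nsa_surj H x : nsa H -> exists u, H (u, x - u).
Proof.
move=> nH; have oH := nsa_op nH; have /is_operatorP[H0 _ _] := oH.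
pose s (p q : U * U) : R := rdot (p.1 + p.2) (q.1 + q.2).
pose phi (p : U * U) : R := rdot (p.1 + p.2) x.
have pf : pre_form H s.
  split.
  - by move=> r [u y] [u' y']; apply: nsa_comb.
  - by move=> p q _ _; rewrite /s rdotC.
  - by move=> r [u y] [u' y'] [u2 y2] _ _ _; rewrite /s /= !rdotE; ring.
  - by move=> [u y] _; apply: rdotxx_ge0.
have [] := riesz_seq (phi := phi) (rdotxx_ge0 x) pf.
- by exists (0, 0).
- by move=> r [u y] [u' y'] _ _; rewrite /phi /= !rdotE; ring.
- by move=> [u y] _; rewrite /phi /s mulrC rdot_CS2.
move=> e [He ce limh].
have [|z ez] := @cauchy2_tends R U (fun n => (e n).1 + (e n).2).
  move=> r /ce[N hN]; exists N => n m Nn Nm; apply: le_lt_trans (hN _ _ Nn Nm).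
  by rewrite /s /= opprD addrACA.
have [|u eu] := @cauchy2_tends R U (fun n => (e n).1).
  move=> r /ce[N hN]; exists N => n m Nn Nm; apply: le_lt_trans (hN _ _ Nn Nm).
  have Hab : H ((e n).1 - (e m).1, (e n).2 - (e m).2).
    by apply: nsa_sub => //; rewrite -surjective_pairing.
  have := nsa_ge0 nH Hab; rewrite /s /=.
  move: ((e n).1 - (e m).1) ((e n).2 - (e m).2) => a b.
  have := rdotxx_ge0 b.
  rewrite !rdotE (rdotC a b); lra.
have Huz : H (u, z - u).
  apply: (nsa_closed (u := fun n => (e n).1) (v := fun n => (e n).2) nH) => //.
    by move=> n; have := He n; case: (e n).
  have -> : (fun n => (e n).2) = (fun n => (e n).1 + (e n).2 - (e n).1).
    by apply/funext => n; rewrite addrC addKr.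
  exact: tendsB.
suff -> : x = z by exists u.
apply/eqP; rewrite -subr_eq0; apply/eqP; apply: (nsa_orth nH) => u1 y1 H1.
rewrite rdotDr rdotNr; apply/eqP; rewrite subr_eq0; apply/eqP.
apply: (cvg_inj (limh _ H1)); rewrite rdotC; exact: tends_rdotl.
Qed.

(** The resolvent [(1 + H)^-1]. *)
Lemma nsa_resolvent H : nsa H -> exists G : U -> U,
  [/\ sa_contraction G, sa_contraction (fun x => x - G x),
      (forall x, G x = 0 -> x = 0)
    & forall u y, H (u, y) <-> exists2 x, u = G x & y = x - G x].
Proof.
move=> nH; have oH := nsa_op nH; have /is_operatorP[H0 Hl Hf] := oH.
pose G x := projT1 (cid (nsa_surj x nH)).
have HG x : H (G x, x - G x) by rewrite /G; case: cid.
have GU x u : H (u, x - u) -> u = G x.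
  move=> Hu; apply/eqP; rewrite -subr_eq0; apply/eqP; apply: (nsa_eigen nH).
  have -> : - (u - G x) = (x - u) - (x - G x).
    by rewrite opprB [RHS]addrC opprB addrA subrK.
  exact: nsa_sub.
have Gl a x y : G (a *: x + y) = a *: G x + G y.
  apply/esym/GU; have := Hl a _ _ _ _ (HG x) (HG y).
  by rewrite scalerBr opprD addrACA.
have Gs x y : rdot (G x) y = rdot x (G y).
  have := nsa_sym nH (HG x) (HG y); rewrite !rdotE; lra.
have Gp x := nsa_ge0 nH (HG x).
have Gn x : rnorm (G x) <= rnorm x /\ rnorm (x - G x) <= rnorm x.
  rewrite -!(@ler_pXn2r _ 2 isT (rnorm _)) ?nnegrE ?rnorm_ge0 // -!rdotxx.
  have := Gp x; have := rdotxx_ge0 (G x); have := rdotxx_ge0 (x - G x).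
  rewrite !rdotE (rdotC (G x) x); lra.
exists G; split.
- by split=> // x; case: (Gn x).
- split; last by move=> x; case: (Gn x).
    by move=> a x y; rewrite Gl scalerBr opprD addrACA.
  by move=> x y; rewrite !rdotE Gs.
- by move=> x Gx0; have := HG x; rewrite Gx0 subr0 => /Hf.
- move=> u y; split=> [Hu|[x -> ->]] //; exists (u + y).
    by apply: GU; rewrite addrC addKr.
  by rewrite -(GU (u + y) u) addrC ?addKr // addrK.
Qed.

(** With [G = (1 + H)^-1], [a = G^(1/2)] and [b = (1 - G)^(1/2)], the graph of
    [H^(1/2)] is the set of the pairs [(a x, b x)]. *)
Lemma nsa_sqrt H : nsa H -> exists2 S, nsa S & opcomp S S = H.
Proof.
move=> nH; have [G [sG sX Ginj HG]] := nsa_resolvent nH.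
have [Y [sY Y2 Yc]] := sac_sqrt sX.
have [Z [sZ Z2 Zc]] := sac_sqrt sG.
have [W [sW W2 Wc]] := sac_sqrt sY.
pose a x := x - Y x; pose b x := x - Z x; pose c x := x - W x.
have GX x : G (x - G x) = G x - G (G x) by apply: sacB.
have YG x : Y (G x) = G (Y x) by rewrite (Yc G).
have ZY x : Z (Y x) = Y (Z x) by rewrite -(Zc Y).
have ZW x : Z (W x) = W (Z x) by rewrite (Wc Z).
have aa x : a (a x) = G x by rewrite /a Y2 opprB addrC subrK.
have bb x : b (b x) = x - G x by rewrite /b Z2.
have cc x : c (c x) = a x by rewrite /c W2.
have symB (P : U -> U) x y : sa_contraction P -> 
    rdot (x - P x) y = rdot x (y - P y).
  by move=> sP; rewrite !rdotE (sac_sym sP).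
have as_ x y : rdot (a x) y = rdot x (a y) by apply: symB.
have bs x y : rdot (b x) y = rdot x (b y) by apply: symB.
have cs x y : rdot (c x) y = rdot x (c y) by apply: symB.
have ab x : a (b x) = b (a x).
  rewrite /a /b (sacB _ _ sY) (sacB _ _ sZ) ZY.
  by apply: rdot_inj => z; rewrite !rdotE; lra.
have cb x : c (b x) = b (c x).
  rewrite /c /b (sacB _ _ sW) (sacB _ _ sZ) ZW.
  by apply: rdot_inj => z; rewrite !rdotE; lra.
have bp x : 0 <= rdot (b x) x.
  rewrite /b !rdotE rdotxx subr_ge0; apply: (le_trans (ler_norm _)).
  apply: (le_trans (rdot_CS _ _)); rewrite expr2.
  by apply: ler_wpM2r; rewrite ?rnorm_ge0 ?(sac_norm sZ).
(* a b is nonnegative, as a is the square of c and c commutes with b. *)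
have abp x : 0 <= rdot (a (b x)) x.
  by rewrite -cc cs cb; apply: bp.
have lB (P : U -> U) k x y : sa_contraction P ->
    k *: x + y - P (k *: x + y) = k *: (x - P x) + (y - P y).
  by move=> sP; rewrite (sac_lin sP) scalerBr opprD addrACA.
have al k x y : a (k *: x + y) = k *: a x + a y by apply: lB.
have bl k x y : b (k *: x + y) = k *: b x + b y by apply: lB.
have aD x y : a (x + y) = a x + a y by have := al 1 x y; rewrite !scale1r.
have bD x y : b (x + y) = b x + b y by have := bl 1 x y; rewrite !scale1r.
have a0 : a 0 = 0 by rewrite /a (sac0 sY) subrr.
have b0 : b 0 = 0 by rewrite /b (sac0 sZ) subrr.
have ainj x : a x = 0 -> x = 0.
  by move=> h; apply: Ginj; rewrite -aa h a0.
pose S : set (U * U) := [set p | exists2 x, p.1 = a x & p.2 = b x].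
have oS : is_operator S.
  apply/is_operatorP; split.
  - by exists 0.
  - move=> k u y u' y' [x /= -> ->] [x' /= -> ->]; exists (k *: x + x') => /=.
      by rewrite al.
    by rewrite bl.
  - by move=> y [x /= /esym/ainj -> ->].
have nS : nsa S.
  split=> //.
  - apply: orth_dense.
    + move=> k u u' [y [x /= -> _]] [y' [x' /= -> _]].
      by exists (b (k *: x + x')); exists (k *: x + x'); rewrite //= al.
    + by exists 0, 0.
    + move=> x h; apply: ainj; apply: rdot_inj => z.
      by rewrite rdot0l as_ rdotC h //; exists (b z), z.
  - move=> u y u' y' [x /= -> ->] [x' /= -> ->].
    by rewrite as_ ab bs.
  - by move=> u y [x /= -> ->]; rewrite -as_.
  - move=> u v h.
    have bu : b u = a v.
      apply: rdot_inj => z; rewrite bs as_ rdotC (rdotC v).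
      by apply: h; exists z.
    exists (a u + b v) => /=.
      by rewrite aD aa ab -bu bb addrC subrK.
    by rewrite bD bb -ab bu aa addrC subrK.
exists S => //; apply/seteqP; split=> -[u y] /=.
- move=> [w [x /= ux wx] [x' /= wx' yx']]; apply/HG.
  (* If b x = a x', then (x, x') = (a z, b z) for z = a x + b x'. *)
  pose z := a x + b x'.
  have az : a z = x by rewrite /z aD aa ab -wx' wx bb addrC subrK.
  have bz : b z = x' by rewrite /z bD bb -ab -wx wx' aa addrC subrK.
  by exists z; rewrite ?ux ?yx' -?az -?bz ?aa ?bb.
- move=> /HG[x ux yx]; exists (b (a x)).
    by exists (a x) => //=; rewrite aa.
  by exists (b x) => /=; rewrite ?ab // bb.
Qed.

End Resolvent.

(** * The operator associated with the form (T f, B g) *)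

Section Factorization.
Variables (R : realType) (U V : hilbertType R).
Variables (T B : set (U * V)).
Hypotheses (oT : is_operator T) (cT : closed T) (oB : is_operator B).

Lemma rdot_i_self (W : hilbertType R) (x : W) : rdot ('i%C *: x) x = 0.
Proof.
have : rdot ('i%C *: x) x = - rdot x ('i%C *: x).
  rewrite rdotZ -rdotNr -scaleNr; congr (rdot _ (_ *: _)).
  by apply/eqP; rewrite eq_complex /= oppr0 !eqxx.
rewrite rdotC; lra.
Qed.

Section Root.
Variables (l : R) (S H : set (U * U)).
Hypotheses (l0 : 0 <= l) (nS : nsa S) (nH : nsa H) (SH : opcomp S S = H).
Hypothesis HT : forall u y, H (u, y) ->
  exists k, [/\ T (u, k), adjoint B (k, y) & rdot k k <= l * rdot y u].

(** An inequality [|T u|^2 <= l (H u, u)] on [dom H] extends to the form domain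
    [dom S], and so does the identity [(T u, B g) = (H u, g) = (S u, S g)]. *)
Lemma root_extend f v : S (f, v) -> exists k,
  [/\ T (f, k), rdot k k <= l * rdot v v
    & forall g m w, B (g, m) -> S (g, w) -> rdot k m = rdot v w].
Proof.
move=> /(root_core_dom nS nH SH)[u [w [y [Sn uf wv]]]].
have Hn n : H (u n, y n) by rewrite -SH; have [h1 h2] := Sn n; exists (w n).
pose k n := projT1 (cid (HT (Hn n))).
have kn n : [/\ T (u n, k n), adjoint B (k n, y n)
    & rdot (k n) (k n) <= l * rdot (y n) (u n)] by rewrite /k; case: cid.
have /is_operatorP[T0 Tl Tf] := oT.
have ksub n m : rdot (k n - k m) (k n - k m) <=
    l * rdot (w n - w m) (w n - w m).
  have [Sn1 Sn2] := Sn n; have [Sm1 Sm2] := Sn m.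
  have Hnm := nsa_sub nH (Hn n) (Hn m).
  have [k' [Tk' _ hk']] := HT Hnm.
  have -> : k n - k m = k'.
    have [Tn _ _] := kn n; have [Tm _ _] := kn m.
    have := Tl (-1) _ _ _ _ Tm Tn; rewrite !scaleN1r ![- _ + _]addrC => h.
    exact: (oT.2 _ _ _ h Tk').
  by rewrite -(root_form nS (nsa_sub nS Sn1 Sm1) (nsa_sub nS Sn2 Sm2)).
have [|k' kk'] := @cauchy2_tends R V k.
  move=> e e0; have l1 : 0 < l + 1 by have := l0; lra.
  have e1 := divr_gt0 e0 l1.
  have [N hN] := tends_cauchy2 wv e1; exists N => n m Nn Nm.
  apply: (le_lt_trans (ksub n m)); have := hN n m Nn Nm.
  rewrite /= ltr_pdivlMr //.
  have := rdotxx_ge0 (w n - w m); lra.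
exists k'; split.
- by apply: (tends_pair_closed cT _ uf kk') => n; case: (kn n).
- apply: (cvg_le_cvg (tends_rdotxx kk')).
    by apply: cvgM; [exact: cvg_cst|exact: (tends_rdotxx wv)].
  move=> n /=; have [_ _ h] := kn n; have [h1 h2] := Sn n.
  by rewrite -(root_form nS h1 h2).
- move=> g m z Bg Sg; apply: (cvg_inj (tends_rdotl (y := m) kk')).
  have -> : (fun n => rdot (k n) m) = (fun n => rdot (w n) z).
    apply/funext => n; have [_ /(adjointP _ _ oB) ad _] := kn n.
    have [h1 h2] := Sn n.
    by rewrite rdotC (ad _ _ Bg) rdotC (nsa_sym nS h2 Sg).
  exact: tends_rdotl.
Qed.

Lemma root_form_eq f v k m : S (f, v) -> T (f, k) -> B (f, m) ->
  '[k, m] = (rdot v v)%:C.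
Proof.
move=> Sf Tf Bf.
have /is_operatorP[S0 Sl _] := nsa_op nS.
have /is_operatorP[T0 Tl _] := oT.
have [k1 [Tk1 _ h1]] := root_extend Sf.
have := Sl 'i%C _ _ _ _ Sf S0; rewrite !addr0 => Sif.
have := Tl 'i%C _ _ _ _ Tf T0; rewrite !addr0 => Tif.
have [k2 [Tk2 _ h2]] := root_extend Sif.
have e1 := h1 _ _ _ Bf Sf; rewrite (oT.2 _ _ _ Tk1 Tf) in e1.
have e2 := h2 _ _ _ Bf Sf; rewrite (oT.2 _ _ _ Tk2 Tif) in e2.
by rewrite hdotE e1 e2 rdot_i_self oppr0.
Qed.

End Root.

Section Construction.
Variable l : R.
Hypothesis dB : dense (dom B).
Hypothesis BT : dom B `<=` dom T.
Hypothesis l0 : 0 <= l.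
Hypothesis tge0 : forall f k m, T (f, k) -> B (f, m) -> 0 <= '[k, m].
Hypothesis tbound : forall f k m, T (f, k) -> B (f, m) ->
  rdot k k <= l * rdot k m.

(** The elements [(f, (T f, B f))] for [f] in [dom B]. *)
Definition joint_graph : set (U * (V * V)) :=
  [set p | T (p.1, p.2.1) /\ B (p.1, p.2.2)].

(** The real part of the sesquilinear form [(T f, B g)]. *)
Definition TB_form (p q : U * (V * V)) : R := rdot p.2.1 q.2.2.

Let D := joint_graph.
Let t := TB_form.

Lemma joint_comb a p q : D p -> D q -> D (a *: p + q).
Proof.
move=> [h1 h2] [h3 h4]; have /is_operatorP[_ Tl _] := oT.
have /is_operatorP[_ Bl _] := oB.
by split; [apply: Tl|apply: Bl].
Qed.

Lemma joint0 : D 0.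
Proof.
have /is_operatorP[T0 _ _] := oT; have /is_operatorP[B0 _ _] := oB.
by split.
Qed.

Lemma jointB p q : D p -> D q -> D (p - q).
Proof.
by move=> Dp Dq; have := joint_comb (-1) Dq Dp; rewrite scaleN1r addrC.
Qed.

Lemma TB_Im p : D p -> rdot ('i%C *: p.2.1) p.2.2 = 0.
Proof.
move=> [h1 h2]; have := tge0 h1 h2; rewrite hdotE lecE /= => /andP[/eqP h _].
lra.
Qed.

Lemma TB_sym p q : D p -> D q -> t p q = t q p.
Proof.
move=> Dp Dq.
(* Polarization: the form is real at 'i p + q. *)
have := TB_Im (joint_comb 'i%C Dp Dq); rewrite /t /TB_form /=.
have ii (W : hilbertType R) (x : W) : 'i%C *: ('i%C *: x) = - x.
  by rewrite scalerA -expr2 sqr_i scaleN1r.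
have i2 (W : hilbertType R) (x y : W) : rdot ('i%C *: x) ('i%C *: y) = rdot x y.
  rewrite rdotZ scalerA; congr rdot; rewrite -[RHS]scale1r; congr (_ *: _).
  by apply/eqP; rewrite eq_complex /=; apply/andP; split; apply/eqP; ring.
have h1 := TB_Im Dp; have h2 := TB_Im Dq.
have := i2 _ ('i%C *: p.2.1) p.2.2; rewrite ii rdotNl h1 => h3.
rewrite scalerDr ii !rdotE i2 h2; lra.
Qed.

Lemma TB_pre_form : pre_form D t.
Proof.
split.
- by move=> r p q; apply: joint_comb.
- exact: TB_sym.
- by move=> r p q z _ _ _; rewrite /t /TB_form /= !rdotE.
- by move=> p [h1 h2]; have := tge0 h1 h2; rewrite hdotE lecE /= => /andP[].
Qed.

Let tp := TB_pre_form.

Lemma TB_cauchy_bounded e :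
  (forall n, D (e n)) -> cauchy2 (fun p => t p p) e ->
  exists2 C, 0 < C & exists N, forall n, (N <= n)%N -> t (e n) (e n) <= C.
Proof.
move=> De /(_ 1 ltr01)[N hN]; exists (2 + 2 * t (e N) (e N)).
  by have := pf_ge0 tp (De N); lra.
exists N => n Nn; have := hN n N Nn (leqnn _).
(* t[e n] <= 2 t[e n - e N] + 2 t[e N], because t[e n - 2 e N] >= 0. *)
have := pf_ge0 tp (joint_comb (-2) (De N) (De n)).
have := pf_sym tp (De n) (De N).
rewrite /t /TB_form /= (_ : (-2 : R[i]) = (-2 : R)%:C); last first.
  by rewrite rmorphN rmorph_nat.
rewrite !rdotE; lra.
Qed.

(** [approx e f]: the sequence [e] exhibits [f] as an element of the domain of
    the closure of the form. *)
Definition approx (e : nat -> U * (V * V)) f :=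
  [/\ forall n, D (e n), tends (fun n => (e n).1) f
    & cauchy2 (fun p => t p p) e].

Lemma approx_T e f : approx e f ->
  exists2 k, T (f, k) & tends (fun n => (e n).2.1) k.
Proof.
move=> [De ef ce]; have [|k ek] := @cauchy2_tends R V (fun n => (e n).2.1).
  move=> r r0; have l1 : 0 < l + 1 by have := l0; lra.
  have r1 := divr_gt0 r0 l1.
  have [N hN] := ce _ r1; exists N => n m Nn Nm.
  have := hN n m Nn Nm; rewrite /= ltr_pdivlMr //.
  have Dnm := jointB (De n) (De m).
  have := pf_ge0 tp Dnm.
  have [h1 h2] := Dnm; have := tbound h1 h2; rewrite /t /TB_form /=; lra.
exists k => //.
by apply: (tends_pair_closed cT _ ef ek) => n; case: (De n).
Qed.

(** The operator associated with the closure of the form [(T f, B g)]: the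
    restriction of [B^* T] to the domain of that closure. *)
Definition TB_operator : set (U * U) :=
  [set p | exists k e, [/\ T (p.1, k), adjoint B (k, p.2) & approx e p.1]].

Let H := TB_operator.

Lemma approx_limT e f k : approx e f -> T (f, k) ->
  tends (fun n => (e n).2.1) k.
Proof.
by move=> /approx_T[k' Tk' ek] Tk; rewrite -(oT.2 _ _ _ Tk' Tk).
Qed.

(** [(B^* T f, f')] is the limit of the form along approximating sequences; the
    sequence [B e'_n] may be unbounded, and the Cauchy property of [e] for the
    form compensates for this. *)
Lemma TB_form_lim e e' f f' k y : approx e f -> approx e' f' -> T (f, k) ->
  adjoint B (k, y) -> (fun n => t (e n) (e' n)) @ \oo --> rdot y f'.
Proof.
move=> ae ae' Tk /(adjointP _ _ oB) ad.
have ek := approx_limT ae Tk.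
have [De ef ce] := ae; have [De' ef' ce'] := ae'.
have lim1 : (fun n => rdot y (e' n).1) @ \oo --> rdot y f'.
  exact: (tends_rdotr ef').
rewrite -[X in _ --> X]addr0.
have -> : (fun n => t (e n) (e' n)) =
    (fun n => rdot y (e' n).1 + rdot ((e n).2.1 - k) (e' n).2.2).
  apply/funext => n; have [_ Bn] := De' n.
  by rewrite !rdotE (rdotC k) (ad _ _ Bn) (rdotC y) addrC subrK.
apply: cvgD => //; apply: sqr_cvg0; apply/cvg0P => r r0.
have [C C0 [N1 hN1]] := TB_cauchy_bounded De' ce'.
have r1 : 0 < r / (2 * C) by rewrite divr_gt0 // mulr_gt0.
have [N2 hN2] := ce _ r1; exists (maxn N1 N2) => n.
rewrite geq_max => /andP[n1 n2]; rewrite ger0_norm ?sqr_ge0 //.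
suff : rdot ((e n).2.1 - k) (e' n).2.2 ^+ 2 <= r / 2 by lra.
(* For fixed n, the difference e n - e j is controlled by the form, and j tends
   to infinity. *)
have limj :
    (fun j => rdot ((e n).2.1 - (e (j + N2)%N).2.1) (e' n).2.2 ^+ 2 : R) @ \oo
    --> (rdot ((e n).2.1 - k) (e' n).2.2 ^+ 2 : R).
  rewrite expr2; under eq_fun do rewrite expr2.
  have h : tends (fun j => (e n).2.1 - (e (j + N2)%N).2.1) ((e n).2.1 - k).
    apply: tendsB; first exact: tends_cst.
    apply/tendsE => d d0; have /tendsE/(_ d d0)[N hN] := ek.
    by exists N => j Nj; apply: hN; apply: (leq_trans Nj); rewrite leq_addr.
  by apply: cvgM; apply: tends_rdotl.
apply: (cvg_le_const limj) => j.
have Dj := jointB (De n) (De (j + N2)%N).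
have /= := form_CS tp Dj (De' n); rewrite {1}/t {1}/TB_form /=.
move=> /le_trans; apply.
have h1 := hN1 n n1; have h2 := hN2 n (j + N2)%N n2 (leq_addl _ _).
have h3 := pf_ge0 tp Dj; have h4 := pf_ge0 tp (De' n).
have -> : r / 2 = r / (2 * C) * C by field; lra.
apply: ler_pM => //; exact: ltW.
Qed.

Lemma TB_operatorP : is_operator H.
Proof.
have /is_operatorP[T0 Tl Tf] := oT.
apply/is_operatorP; split.
- exists 0, (fun=> 0); split=> //=.
    by apply/adjointP => // f k _; rewrite !rdot0r.
  split; [by move=> n; exact: joint0|exact: tends_cst|].
  move=> r r0; exists 0%N => n m _ _.
  by rewrite subrr /t /TB_form /= rdot0l.
- move=> a f y f' y' [k [e /= [Tk ad [De ef ce]]]].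
  move=> [k' [e' /= [Tk' ad' [De' ef' ce']]]].
  exists (a *: k + k'), (fun n => a *: e n + e' n); split => /=.
  + exact: Tl.
  + exact: adjoint_comb.
  + split; [by move=> n; apply: joint_comb| |].
      by apply: tendsD => //; apply: tendsZ.
    pose c : R := complex.Re `|a| ^+ 2.
    have ta p : t (a *: p) (a *: p) = c * t p p.
      rewrite /t /TB_form /= rdotZ scalerA -rdotZr; congr (rdot _ (_ *: _)).
      rewrite mulrC -normCK /c; case: (`|a|) (normr_ge0 a) => x z.
      rewrite lecE /= => /andP[/eqP -> _]; rewrite !expr2.
      by apply/eqP; rewrite eq_complex /=; apply/andP; split; apply/eqP; ring.
    have c0 : 0 <= c by rewrite /c sqr_ge0.
    move=> r r0; have c1 : 0 < 4 * (c + 1) by lra.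
    have r1 := divr_gt0 r0 c1; have r2 : 0 < r / 4 by lra.
    have [N hN] := ce _ r1; have [N' hN'] := ce' _ r2.
    exists (maxn N N') => n m; rewrite !geq_max => /andP[n1 n2] /andP[m1 m2].
    have Dp := jointB (De n) (De m); have Dq := jointB (De' n) (De' m).
    have -> : a *: e n + e' n - (a *: e m + e' m) =
        a *: (e n - e m) + (e' n - e' m).
      by rewrite scalerBr opprD addrACA.
    have := hN n m n1 m1; have := hN' n m n2 m2.
    move: (e n - e m) (e' n - e' m) Dp Dq => p q Dp Dq hq.
    rewrite ltr_pdivlMr //.
    have Dap : D (a *: p) by have := joint_comb a Dp joint0; rewrite addr0.
    have := pf_ge0 tp (jointB Dap Dq); have := TB_sym Dap Dq.
    have := pf_ge0 tp Dp; have := ta p; move: hq.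
    rewrite /t /TB_form /= !rdotE; lra.
- move=> y [k [e /= [/Tf -> ad _]]]; apply: (dense_orth dB) => u [m Bu].
  by move/(adjointP _ _ oB): ad => /(_ _ _ Bu) <-; rewrite rdot0r.
Qed.

Lemma TB_operator_form f y e k : approx e f -> T (f, k) -> adjoint B (k, y) ->
  (fun n => t (e n) (e n)) @ \oo --> rdot y f.
Proof. by move=> ae; apply: TB_form_lim. Qed.

Lemma TB_operator_sym f y f' y' : H (f, y) -> H (f', y') ->
  rdot y f' = rdot f y'.
Proof.
move=> [k [e /= [Tk ad ae]]] [k' [e' /= [Tk' ad' ae']]].
apply: (cvg_inj (TB_form_lim ae ae' Tk ad)).
have -> : (fun n => t (e n) (e' n)) = (fun n => t (e' n) (e n)).
  by apply/funext => n; apply: TB_sym; [case: ae|case: ae'].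
by rewrite rdotC; apply: TB_form_lim ae' ae Tk' ad'.
Qed.

Lemma TB_operator_bound f y : H (f, y) ->
  exists k, [/\ T (f, k), adjoint B (k, y) & rdot k k <= l * rdot y f].
Proof.
move=> [k [e /= [Tk ad ae]]]; exists k; split=> //.
apply: (cvg_le_cvg (tends_rdotxx (approx_limT ae Tk))).
  by apply: cvgM; [exact: cvg_cst|exact: (TB_operator_form ae Tk ad)].
by move=> n /=; have [De _ _] := ae; have [h1 h2] := De n; apply: tbound h1 h2.
Qed.

Lemma TB_operator_ge0 f y : H (f, y) -> 0 <= rdot y f.
Proof.
move=> [k [e /= [Tk ad ae]]].
apply: (cvg_ge_const (TB_operator_form ae Tk ad)) => n.
by have [De _ _] := ae; apply: (pf_ge0 tp).
Qed.

(** The Cauchy-Schwarz inequality for the closure of the form. *)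
Lemma TB_operator_CS f y g k m : H (f, y) -> T (g, k) -> B (g, m) ->
  rdot y g ^+ 2 <= rdot y f * rdot k m.
Proof.
move=> [k' [e /= [Tk' ad ae]]] Tg Bg; have [De ef ce] := ae.
have -> : rdot y g = rdot k' m.
  move/(adjointP _ _ oB): ad => /(_ _ _ Bg).
  by rewrite rdotC => ->; rewrite rdotC.
have h1 := tends_rdotl (y := m) (approx_limT ae Tk').
have h2 := TB_operator_form ae Tk' ad.
apply: (@cvg_le_cvg R (fun n => rdot (e n).2.1 m ^+ 2)
  (fun n => t (e n) (e n) * rdot k m)).
- by rewrite expr2; under eq_fun do rewrite expr2; apply: cvgM.
- by apply: cvgM => //; exact: cvg_cst.
- move=> n; have Dg : D (g, (k, m)) by split.
  exact: (form_CS tp (De n) Dg).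
Qed.

(** A solution of [f + H f = x] is the limit of a sequence minimizing
    [|f|^2 + (T f, B f) - 2 Re (f, x)] on [dom B]. *)
Lemma TB_operator_surj x : exists f, H (f, x - f).
Proof.
pose s (p q : U * (V * V)) : R := rdot p.1 q.1 + t p q.
have pf : pre_form D s.
  split.
  - by move=> r p q; apply: joint_comb.
  - by move=> p q Dp Dq; rewrite /s (TB_sym Dp Dq) rdotC.
  - by move=> r p q z _ _ _; rewrite /s /t /TB_form /= !rdotE; ring.
  - by move=> p Dp; rewrite addr_ge0 ?rdotxx_ge0 ?(pf_ge0 tp).
have [] := riesz_seq (phi := fun p => rdot p.1 x) (rdotxx_ge0 x) pf.
- by exists 0; apply: joint0.
- by move=> r p q _ _ /=; rewrite !rdotE.
- move=> p Dp; apply: (le_trans (rdot_CS2 _ _)); rewrite mulrC.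
  by apply: ler_wpM2l; rewrite ?rdotxx_ge0 // lerDl (pf_ge0 tp).
move=> e [De ce he].
have [|f ef] := @cauchy2_tends R U (fun n => (e n).1).
  move=> r /ce[N hN]; exists N => n m Nn Nm.
  apply: le_lt_trans (hN _ _ Nn Nm).
  by rewrite lerDl (pf_ge0 tp) //; apply: jointB.
have ae : approx e f.
  split=> // r /ce[N hN]; exists N => n m Nn Nm.
  apply: le_lt_trans (hN _ _ Nn Nm).
  by rewrite lerDr rdotxx_ge0.
have [k Tk ek] := approx_T ae.
exists f, k, e; split=> //=; apply/adjointP => // g m Bg.
have [k' Tg] : dom T g by apply: BT; exists m.
have Dg : D (g, (k', m)) by split.
have h : (fun n => s (e n) (g, (k', m))) @ \oo --> (rdot f g + rdot k m : R).
  by apply: cvgD; apply: tends_rdotl.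
have := cvg_inj (he _ Dg) h; rewrite /= !rdotE (rdotC m) (rdotC f g) => ->.
by rewrite addrC addKr.
Qed.

Lemma TB_operator_nsa : nsa H.
Proof.
apply: nsa_range.
- exact: TB_operatorP.
- exact: TB_operator_sym.
- exact: TB_operator_ge0.
- exact: TB_operator_surj.
Qed.

(** The form domain of [H], which is [dom S] for a square root [S] of [H],
    contains [dom B]. *)
Lemma TB_operator_dom S f m : nsa S -> opcomp S S = H -> B (f, m) ->
  dom S f.
Proof.
move=> nS SH Bf; have [k Tf] : dom T f by apply: BT; exists m.
have Df : D (f, (k, m)) by split.
have tf : 0 <= rdot k m by have := pf_ge0 tp Df.
have [|u y Hu|u [w [y [v [_ _ _ Sf]]]]] :=
  @root_core R U S H nS TB_operator_nsa SH (rdot f f + rdot k m) f.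
- by rewrite addr_ge0 ?rdotxx_ge0.
- rewrite rdotDl; apply: CS_sum; rewrite ?rdotxx_ge0 ?rdot_CS2 //.
    exact: TB_operator_ge0 Hu.
  exact: TB_operator_CS Hu Tf Bf.
- by exists v.
Qed.

End Construction.
End Factorization.

(** * Factorizations and domination *)

Section SquareRootOf.
Variables (R : realType) (U : hilbertType R).
Implicit Types H S : set (U * U).

(** A nonempty [opsqrt H] is a square root, as the default value is empty. *)
Lemma opsqrtP H f : dom (opsqrt H) f ->
  nsa (opsqrt H) /\ opcomp (opsqrt H) (opsqrt H) = H.
Proof.
move=> [g]; rewrite /opsqrt; case: xgetP => [S -> [/nsaP]|//]; by split.
Qed.

Lemma opsqrt_nsa H : nsa H ->
  nsa (opsqrt H) /\ opcomp (opsqrt H) (opsqrt H) = H.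
Proof.
move=> /nsa_sqrt[S nS SH]; rewrite /opsqrt; case: xgetP => [S' _ [/nsaP]|h].
  by split.
by case: (h S); split=> //; apply/nsaP.
Qed.

End SquareRootOf.

Section Inequalities.
Variables (R : realType) (V : hilbertType R).
Implicit Types (l : R) (k m : V).

Lemma normr2E k : `|k| ^+ 2 = (rdot k k)%:C.
Proof. by rewrite normE -rmorphXn rdotxx. Qed.

Lemma scaled_hdot_ge k m l c : c%:C <= l%:C * '[k, m] <->
  c <= l * rdot k m /\ l * rdot ('i%C *: k) m = 0.
Proof.
rewrite hdotE; set a := rdot k m; set b := rdot _ m.
have -> : l%:C * Complex a (- b) = Complex (l * a) (- (l * b)).
  by apply/eqP; rewrite eq_complex /=; apply/andP; split; apply/eqP; ring.
rewrite lecE /= oppr_eq0; split=> [/andP[/eqP ? ?]|[-> ->]] //.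
by rewrite eqxx.
Qed.

(** The expansion of [0 <= |l m - k|^2]. *)
Lemma form_bound k m l : rdot k k <= l * rdot k m ->
  l * rdot k m <= l ^+ 2 * rdot m m.
Proof.
have := rdotxx_ge0 (l%:C *: m - k); rewrite !rdotE (rdotC m k); lra.
Qed.

End Inequalities.

Section Equivalence.
Variables (R : realType) (U V : hilbertType R).
Variables (T B : set (U * V)).
Hypotheses (cT : closed_densely_defined T) (cB : closed_densely_defined B).

(** The inequality [|T f|^2 <= l (T f, B f)] on [dom B]. *)
Definition dominated (l : R) := forall f, dom B f ->
  `|opval T f| ^+ 2 <= l%:C * '[opval T f, opval B f].

Lemma dominated_upper l f : dominated l -> dom B f ->
  l%:C * '[opval T f, opval B f] <= l%:C ^+ 2 * `|opval B f| ^+ 2.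
Proof.
move=> h /h; rewrite !normr2E => /scaled_hdot_ge[h1 h2].
rewrite hdotE -rmorphXn /= -rmorphM /=.
have -> x y : l%:C * Complex x (- y) = Complex (l * x) (- (l * y)).
  by apply/eqP; rewrite eq_complex /=; apply/andP; split; apply/eqP; ring.
by rewrite h2 oppr0 lecE /= eqxx form_bound.
Qed.

Lemma dominated_factor l : dom B `<=` dom T -> 0 <= l -> dominated l ->
  exists H, factor_between T B l H.
Proof.
have [oT clT _] := cT; have [oB _ dB] := cB.
move=> BT l0 h.
have hk f k m : T (f, k) -> B (f, m) ->
    rdot k k <= l * rdot k m /\ l * rdot ('i%C *: k) m = 0.
  move=> Tf Bf; have df : dom B f by exists m.
  apply/scaled_hdot_ge; rewrite -normr2E.
  by have := h _ df; rewrite (opval_eq oT Tf) (opval_eq oB Bf).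
have tge0 f k m : T (f, k) -> B (f, m) -> 0 <= '[k, m].
  move=> Tf Bf; have [h1 h2] := hk _ _ _ Tf Bf.
  (* For l = 0 the inequality says that T f = 0. *)
  have [l_0|l_n0] := eqVneq l 0.
    have -> : k = 0 by apply: rdotxx_eq0; rewrite l_0 mul0r in h1.
    by rewrite linear0l.
  have lp : 0 < l by rewrite lt_neqAle eq_sym l_n0.
  move/eqP: h2; rewrite mulf_eq0 (negbTE l_n0) /= => /eqP h2.
  rewrite hdotE h2 oppr0 lecE /= eqxx /=.
  by rewrite -(pmulr_rge0 _ lp); apply: le_trans h1; apply: rdotxx_ge0.
have tbound f k m : T (f, k) -> B (f, m) -> rdot k k <= l * rdot k m.
  by move=> Tf Bf; have [] := hk _ _ _ Tf Bf.
pose H := TB_operator T B; exists H.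
have nH : nsa H by apply: (@TB_operator_nsa _ _ _ T B oT clT oB l).
have HT u y : H (u, y) ->
    exists k, [/\ T (u, k), adjoint B (k, y) & rdot k k <= l * rdot y u].
  exact: (@TB_operator_bound _ _ _ T B oT clT oB l).
have [nS SH] := opsqrt_nsa nH; set S := opsqrt H in nS SH *.
have oS := nsa_op nS.
split; [|split|split].
- split; first exact/nsaP.
  by move=> [u y] /HT[k [Tu Bk _]]; exists k.
- by move=> f [v /(root_extend oT clT oB l0 nS nH SH HT)[k [Tf _ _]]]; exists k.
- move=> f [v Sf].
  have [k [Tf kv _]] := root_extend oT clT oB l0 nS nH SH HT Sf.
  rewrite (opval_eq oT Tf) (opval_eq oS Sf) !normr2E.
  by rewrite mul1r -rmorphM lecR.
- move=> f [m Bf].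
  exact: (@TB_operator_dom _ _ _ T B oT clT oB l _ _ _ _ _ S f m).
- move=> f [m Bf].
  have [v Sf] : dom S f.
    exact: (@TB_operator_dom _ _ _ T B oT clT oB l _ _ _ _ _ S f m).
  have [k Tf] : dom T f by apply: BT; exists m.
  rewrite (opval_eq oS Sf) (opval_eq oB Bf) !normr2E -!rmorphM /= lecR.
  have := root_form_eq oT clT oB l0 nS nH SH HT Sf Tf Bf.
  rewrite hdotE => -[<- _]; apply: form_bound; exact: tbound Tf Bf.
Qed.

Lemma factor_dominated l H : 0 <= l -> factor_above T B l H ->
  dom B `<=` dom T /\ dominated l.
Proof.
have [oT clT _] := cT; have [oB _ dB] := cB.
move=> l0 [[/nsaP nH HBT] [ST hST] BS].
have [nS SH] : nsa (opsqrt H) /\ opcomp (opsqrt H) (opsqrt H) = H.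
  apply: (@opsqrtP _ _ _ 0); apply: BS; exists 0.
  by have /is_operatorP[] := oB.
move: nS SH ST hST BS; set S := opsqrt H => nS SH ST hST BS.
have oS := nsa_op nS.
have HT u y : H (u, y) ->
    exists k, [/\ T (u, k), adjoint B (k, y) & rdot k k <= l * rdot y u].
  move=> Hu; have [k /= Tu Bk] := HBT _ Hu; exists k; split=> //.
  have [w Su Sw] := root_split SH Hu.
  have /hST : dom S u by exists w.
  rewrite (opval_eq oT Tu) (opval_eq oS Su) mul1r !normr2E -rmorphM lecR.
  by rewrite (root_form nS Su Sw).
split; first by move=> f /BS/ST.
move=> f df; have [v Sf] := BS _ df; have [k Tf] := ST _ (BS _ df).
have [m Bf] := df; have /hST := BS _ df.
rewrite (opval_eq oT Tf) (opval_eq oS Sf) (opval_eq oB Bf).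
rewrite (root_form_eq oT clT oB l0 nS nH SH HT Sf Tf Bf).
by rewrite mul1r [`|v| ^+ 2]normr2E.
Qed.

Lemma factor_eq H : Defs.factor T B H -> selfadjoint (opcomp (adjoint B) T) ->
  H = opcomp (adjoint B) T.
Proof.
move=> [/nsaP nH HM] [oM _ eM]; apply/seteqP; split=> // -[g h].
rewrite [X in X _ -> _]eM => /(adjointP _ _ oM) ad.
by apply: (nsa_max nH) => u y /HM; apply: ad.
Qed.

End Equivalence.

Theorem proposition2p1 (R : realType) (U V : hilbertType R)
    (T B : set (U * V)) :
  closed_densely_defined T -> closed_densely_defined B ->
  [<-> (dom B `<=` dom T /\
         exists2 l : R, 0 <= l & forall f, dom B f ->
           `|opval T f| ^+ 2 <= l%:C * '[opval T f, opval B f]);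
       (dom B `<=` dom T /\
         exists2 l : R, 0 <= l & forall f, dom B f ->
           `|opval T f| ^+ 2 <= l%:C * '[opval T f, opval B f] /\
           l%:C * '[opval T f, opval B f]
             <= l%:C ^+ 2 * `|opval B f| ^+ 2);
       (exists2 l : R, 0 <= l & exists H, factor_between T B l H);
       (exists2 l : R, 0 <= l & exists H, factor_above T B l H)]
  /\ (selfadjoint (opcomp (adjoint B) T) ->
       forall (l : R) (H : set (U * U)), 0 <= l ->
         factor_between T B l H \/ factor_above T B l H ->
         H = opcomp (adjoint B) T).
Proof.
move=> cT cB; split; last first.
  by move=> sM l H _ [[fH _ _]|[fH _ _]]; apply: factor_eq.
tfae.
- move=> [BT [l l0 h]]; split=> //; exists l => // f df.
  by split; [exact: h|exact: (dominated_upper h df)].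
- move=> [BT [l l0 h]]; exists l => //.
  by apply: (dominated_factor cT cB BT l0) => f /h[].
- move=> [l l0 [H [fH TH [BH _]]]]; exists l => //.
  by exists H; split.
- move=> [l l0 [H fH]].
  by have [BT h] := factor_dominated cT cB l0 fH; split=> //; exists l.
Qed.
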